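(* The topological stable rank of the Banach algebra $\mathscr{H}^\infty$ of bounded Dirichlet series is infinite.
   Context: Let $\mathbb{N}=\{1,2,3,\dots\}$ and $\mathbb{C}_{>0}=\{s\in\mathbb{C}:\operatorname{Re}(s)>0\}$. $\mathscr{H}^\infty$ denotes the set of Dirichlet series $f(s)=\sum_{n=1}^\infty \frac{a_n}{n^s}$, where $(a_n)_{n\in\mathbb{N}}$ is a sequence of complex numbers, such that $f$ is holomorphic and bounded in $\mathbb{C}_{>0}$ (i.e. the bounded holomorphic functions $f$ on $\mathbb{C}_{>0}$ that are represented by a Dirichlet series converging in some half-plane $\operatorname{Re}(s)>\sigma_0$; by a theorem of Bohr the series then converges in all of $\mathbb{C}_{>0}$). With pointwise operations and the norm $\|f\|_\infty=\sup_{s\in\mathbb{C}_{>0}}|f(s)|$, $\mathscr{H}^\infty$ is a unital commutative complex Banach algebra. Topological stable rank: Let $R$ be a commutative complex Banach algebra with unit element $1$. For $n\in\mathbb{N}$, $U_n(R)$ denotes the set of unimodular elements of $R^n$, i.e. those $(a_1,\dots,a_n)\in R^n$ for which there exist $b_1,\dots,b_n\in R$ with $b_1a_1+\cdots+b_na_n=1$. The topological stable rank of $R$ is the least integer $n\in\mathbb{N}$ for which $U_n(R)$ is dense in $R^n$ (with the product topology); if no such integer $n$ exists, the topological stable rank of $R$ is infinite. *)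

(* Defs.v *)
From HB Require Import structures.
From mathcomp Require Import all_boot all_order all_algebra.
From mathcomp Require Import zify ring lra complex.
From mathcomp Require Import all_classical all_reals all_analysis.

Set Implicit Arguments.
Unset Strict Implicit.
Unset Printing Implicit Defensive.

Import Order.TTheory GRing.Theory Num.Theory numFieldNormedType.Exports.

Local Open Scope classical_set_scope.
Local Open Scope ring_scope.
Local Open Scope complex_scope.

(* No compatibility between the topology and the ring operations is required:
   the topological stable rank only uses the ring and the topology. *)
#[short(type="preTopologicalComNzRingType")]
HB.structure Definition PreTopologicalComNzRing :=
  {A of Topological A & GRing.ComNzRing A}.

Definition unimodular (A : comNzRingType) (n : nat) : set 'rV[A]_n :=
  [set a | exists b : 'rV[A]_n, \sum_(i < n) b 0 i * a 0 i = 1].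

(* ['rV[A]_n] carries the product topology of [A ^ n]. *)
Section topological_stable_rank.
Variable A : preTopologicalComNzRingType.

Definition unimodular_dense (n : nat) : Prop :=
  (0 < n)%N /\ dense (@unimodular A n : set 'rV[A]_n).

Definition topological_stable_rank : \bar nat :=
  match pselect (exists n, `[< unimodular_dense n >]) with
  | left ex_n => (ex_minn ex_n)%:E
  | right _ => +oo%E
  end.

Lemma topological_stable_rank_pinfty :
  topological_stable_rank = +oo%E <->
  forall n, (0 < n)%N -> ~ dense (@unimodular A n : set 'rV[A]_n).
Proof.
rewrite /topological_stable_rank; case: pselect => [ex_n|nex]; split=> //.
- move=> H; have [n /asboolP[n0 dn]] := ex_n.
  by have := H n n0 dn.
- by move=> _ n n0 dn; apply: nex; exists n; apply/asboolP.
Qed.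

End topological_stable_rank.

(* The analysis library only declares these instances for abstract fields. *)
HB.instance Definition _ (R : rcfType) := GRing.ComAlgebra.copy R[i] R[i]^o.
HB.instance Definition _ (R : rcfType) := NormedModule.copy R[i] R[i]^o.

Local Notation normc := ComplexField.Normc.normc.

Section dirichlet.
Variable R : realType.
Local Notation C := R[i].

Definition cexp (z : C) : C :=
  (expR (complex.Re z))%:C *
  (cos (complex.Im z) +i* sin (complex.Im z)).

(* n ^ (- s), for 0 < n. *)
Definition dirichlet_pow (n : nat) (s : C) : C := cexp (- s * (ln n%:R)%:C).

(* The value [a 0] is irrelevant. *)
Definition dirichlet_sum (a : nat -> C) (s : C) (N : nat) : C :=
  \sum_(1 <= n < N.+1) a n * dirichlet_pow n s.

Definition half_plane : Type := {s : C | 0 < complex.Re s}.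

(* Complex derivatives at points of the open half-plane do not depend on the
   values outside of it; the extension by 0 serves to state differentiability
   with [derivable], which expects a function on the whole of C. *)
Definition extend0 (f : half_plane -> C) (z : C) : C :=
  if insub z is Some s then f s else 0.

Definition hp_holomorphic (f : half_plane -> C) : Prop :=
  forall s : half_plane, derivable (extend0 f) (val s) 1.

Definition hp_bounded (f : half_plane -> C) : Prop :=
  exists M : R, forall s, normc (f s) <= M.

Definition dirichlet_series_rep (f : half_plane -> C) : Prop :=
  exists (a : nat -> C) (sigma0 : R), forall s : half_plane,
    sigma0 < complex.Re (val s) -> dirichlet_sum a (val s) @ \oo --> f s.

Definition Hinf_pred : {pred half_plane -> C} :=
  fun f => `[< [/\ hp_holomorphic f, hp_bounded f & dirichlet_series_rep f] >].

End dirichlet.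

Section dirichlet_lemmas.
Variable R : realType.
Local Notation C := R[i].

Lemma cexpD (z w : C) : cexp (z + w) = cexp z * cexp w.
Proof.
case: z w => [a b] [c d]; rewrite /cexp /= expRD cosD sinD.
by apply/eqP; rewrite eq_complex /=; apply/andP; split; apply/eqP; ring.
Qed.

Lemma normc_cexp (z : C) : normc (cexp z) = expR (complex.Re z).
Proof.
rewrite /cexp ComplexField.Normc.normcM /= expr0n /= addr0 cos2Dsin2 sqrtr1.
by rewrite mulr1 sqrtr_sqr ger0_norm// expR_ge0.
Qed.

Lemma dirichlet_powM m n (s : C) : (0 < m)%N -> (0 < n)%N ->
  dirichlet_pow (m * n) s = dirichlet_pow m s * dirichlet_pow n s.
Proof.
move=> m0 n0; rewrite /dirichlet_pow -cexpD -mulrDr -rmorphD natrM.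
by rewrite lnM// posrE ltr0n.
Qed.

Lemma dirichlet_pow1 (s : C) : dirichlet_pow 1 s = 1.
Proof.
rewrite /dirichlet_pow ln1 mulr0 /cexp /= expR0 cos0 sin0.
by apply/eqP; rewrite eq_complex /= !(mul0r, mulr0, subr0, addr0, mulr1) !eqxx.
Qed.

Lemma normc_dirichlet_pow n (s : C) :
  normc (dirichlet_pow n s) = expR (- complex.Re s * ln n%:R).
Proof.
rewrite /dirichlet_pow normc_cexp; congr expR.
by case: s => a b /=; rewrite mulr0 subr0.
Qed.

Lemma normcE (z : C) : `|z| = (normc z)%:C. Proof. by []. Qed.

Lemma normc_ge0 (z : C) : 0 <= normc z.
Proof. by rewrite -ler0c -normcE. Qed.

Lemma ler_normcD (z w : C) : normc (z + w) <= normc z + normc w.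
Proof. by rewrite -lecR rmorphD -!normcE ler_normD. Qed.

Lemma normc_sum (I : Type) (r : seq I) (P : pred I) (F : I -> C) :
  normc (\sum_(i <- r | P i) F i) <= \sum_(i <- r | P i) normc (F i).
Proof.
elim/big_rec2: _ => [|i x y _ le_yx]; first by rewrite ComplexField.Normc.normc0.
by apply: le_trans (ler_normcD _ _) _; rewrite lerD2l.
Qed.

Lemma ccvgP (u : nat -> C) (l : C) : u @ \oo --> l <->
  forall e : R, 0 < e -> \forall n \near \oo, normc (u n - l) < e.
Proof.
split=> [/cvgrPdistC_lt ul e e0|H].
  have := ul e%:C; rewrite ltcR => /(_ e0); apply: filterS => n.
  by rewrite normcE ltcR.
apply/cvgrPdistC_lt => e e0.
have eR : e = (complex.Re e)%:C.
  by apply/eqP; rewrite eq_complex /= eqxx; move: e0; rewrite ltcE => /andP[].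
move: (e0); rewrite eR ltcR => /H; apply: filterS => n.
by rewrite normcE ltcR.
Qed.

Lemma sum_inv_sqr N : \sum_(1 <= n < N.+2) (n%:R ^+ 2)^-1 <= 2 - N.+1%:R^-1 :> R.
Proof.
elim: N => [|N IH].
  by rewrite big_nat1 expr1n invr1; lra.
rewrite big_nat_recr//=; apply: le_trans (lerD IH (lexx _)) _.
have h : 0 < N.+1%:R :> R by [].
have -> : N.+2%:R = N.+1%:R + 1 :> R by rewrite -natr1.
set x : R := N.+1%:R in h *.
rewrite -subr_ge0.
have -> : 2 - (x + 1)^-1 - (2 - x^-1 + ((x + 1) ^+ 2)^-1) =
   (x * (x + 1) ^+ 2)^-1.
  by field; rewrite !lt0r_neq0 // addr_gt0.
by rewrite invr_ge0 mulr_ge0 ?exprn_ge0// ?addr_ge0// ltW.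
Qed.

Lemma sum_inv_sqr_le2 N : \sum_(1 <= n < N.+1) (n%:R ^+ 2)^-1 <= 2 :> R.
Proof.
case: N => [|N]; first by rewrite big_geq.
by apply: le_trans (sum_inv_sqr N) _; rewrite gerBl.
Qed.

Lemma expR_2ln n : (0 < n)%N -> expR (- (2 * ln n%:R)) = (n%:R ^+ 2)^-1 :> R.
Proof.
by move=> n0; rewrite expRN expRM_natl lnK// posrE ltr0n.
Qed.

Lemma dirichlet_abs (a : nat -> C) (s0 l s : C) :
  dirichlet_sum a s0 @ \oo --> l ->
  complex.Re s0 + 2 <= complex.Re s ->
  exists K : R, forall N,
    \sum_(1 <= n < N.+1) normc (a n * dirichlet_pow n s) <= K.
Proof.
move=> /ccvgP/(_ 1 ltr01)[N0 _ HN0] hs.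
pose t n := normc (a n * dirichlet_pow n s0).
pose B := \sum_(0 <= n < N0.+2) t n + 2.
have tB n : t n <= B.
  have [nN|nN] := leqP n N0.+1.
    rewrite /B (bigD1_seq n) ?mem_index_iota ?iota_uniq//= -addrA lerDl.
    by rewrite addr_ge0// sumr_ge0// => i _; exact: normc_ge0.
  apply: (@le_trans _ _ 2); last first.
    by rewrite lerDr sumr_ge0// => i _; exact: normc_ge0.
  case: n nN => // n nN.
  have -> : t n.+1 = normc ((dirichlet_sum a s0 n.+1 - l) +
      - (dirichlet_sum a s0 n - l)).
    rewrite /dirichlet_sum [in RHS]big_nat_recr//=; congr normc.
    by rewrite opprB addrA subrK addrC addKr.
  apply: le_trans (ler_normcD _ _) _;   rewrite complex.normcN.
  have := HN0 n.+1; have := HN0 n; rewrite /= => /(_ ltac:(by apply: ltnW)).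
  move=> h1 /(_ ltac:(by apply: ltnW; apply: ltnW)) h2; lra.
exists (B * 2) => N.
apply: le_trans (_ : \sum_(1 <= n < N.+1) B * (n%:R ^+ 2)^-1 <= _); last first.
  rewrite -big_distrr/= ler_wpM2l ?sum_inv_sqr_le2//.
  by apply: le_trans (tB 0); exact: normc_ge0.
rewrite big_nat_cond [leRHS]big_nat_cond; apply: ler_sum => n.
rewrite andbT => /andP[n1 _].
apply: (@le_trans _ _ (t n * (n%:R ^+ 2)^-1)); last first.
  by rewrite ler_wpM2r// invr_ge0 exprn_ge0.
rewrite /t (ComplexField.Normc.normcM (a n) (dirichlet_pow n s)).
rewrite (ComplexField.Normc.normcM (a n) (dirichlet_pow n s0)) -mulrA ler_wpM2l ?normc_ge0//.
rewrite !normc_dirichlet_pow -expR_2ln// -expRD ler_expR.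
have : 0 <= ln n%:R :> R by rewrite ln_ge0// ler1n.
by nra.
Qed.


Definition dconv (a b : nat -> C) (n : nat) : C :=
  \sum_(1 <= i < n.+1) \sum_(1 <= j < n.+1 | (i * j == n)%N) a i * b j.

Lemma dirichlet_sum_conv (a b : nat -> C) (s : C) (N : nat) :
  dirichlet_sum (dconv a b) s N =
  \sum_(1 <= i < N.+1) \sum_(1 <= j < N.+1 | (i * j < N.+1)%N)
    (a i * dirichlet_pow i s) * (b j * dirichlet_pow j s).
Proof.
rewrite /dirichlet_sum.
transitivity (\sum_(1 <= n < N.+1) \sum_(1 <= i < N.+1)
    \sum_(1 <= j < N.+1 | (i * j == n)%N)
    (a i * dirichlet_pow i s) * (b j * dirichlet_pow j s)).
  rewrite big_nat_cond [RHS]big_nat_cond; apply: eq_bigr => n.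
  rewrite andbT => /andP[n1 nN].
  rewrite /dconv big_distrl/= [RHS](big_cat_nat (n := n.+1))//=.
  rewrite [X in _ = _ + X]big_nat_cond [X in _ = _ + X]big1 ?addr0; last first.
    move=> i; rewrite andbT => /andP[ni _]; rewrite big_nat_cond big1// => j.
    move=> /andP[/andP[j1 _] /eqP ijn].
    by move: ni; rewrite -ijn ltnNge leq_pmulr.
  rewrite big_nat_cond [RHS]big_nat_cond; apply: eq_bigr => i.
  rewrite andbT => /andP[i1 _].
  rewrite big_distrl/= [RHS](big_cat_nat (n := n.+1))//=.
  rewrite [X in _ = _ + X]big_nat_cond [X in _ = _ + X]big1 ?addr0; last first.
    move=> j /andP[/andP[nj _] /eqP ijn].
    by move: nj; rewrite -ijn ltnNge leq_pmull.
  rewrite big_nat_cond [RHS]big_nat_cond; apply: eq_bigr => j.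
  move=> /andP[/andP[j1 _] /eqP <-].
  by rewrite dirichlet_powM// mulrACA.
rewrite exchange_big/= big_nat_cond [RHS]big_nat_cond; apply: eq_bigr => i.
rewrite andbT => /andP[i1 _].
rewrite (exchange_big_dep_nat xpredT)//=.
rewrite [RHS]big_mkcond/= big_nat_cond [RHS]big_nat_cond.
apply: eq_bigr => j; rewrite andbT => /andP[j1 _].
rewrite (eq_bigl (fun n => n == (i * j)%N)); last by move=> n; rewrite eq_sym.
by rewrite big_nat1_eq muln_gt0 i1 j1.
Qed.

Lemma cvg_dirichlet_conv (a b : nat -> C) (s x y : C) (Ka Kb : R) :
  dirichlet_sum a s @ \oo --> x -> dirichlet_sum b s @ \oo --> y ->
  (forall N, \sum_(1 <= n < N.+1) normc (a n * dirichlet_pow n s) <= Ka) ->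
  (forall N, \sum_(1 <= n < N.+1) normc (b n * dirichlet_pow n s) <= Kb) ->
  dirichlet_sum (dconv a b) s @ \oo --> x * y.
Proof.
move=> Ax By.
set al := fun n => a n * dirichlet_pow n s.
set be := fun n => b n * dirichlet_pow n s.
move=> HKa HKb.
pose SA N := \sum_(1 <= n < N.+1) normc (al n).
pose SB N := \sum_(1 <= n < N.+1) normc (be n).
pose P N := SA N * SB N.
have S0 (u : nat -> C) N : 0 <= \sum_(1 <= n < N.+1) normc (u n).
  by rewrite sumr_ge0// => i _; exact: normc_ge0.
have ndS (u : nat -> C) :
    nondecreasing_seq (fun N => \sum_(1 <= n < N.+1) normc (u n)).
  apply/nondecreasing_seqP => n; rewrite [leRHS]big_nat_recr//= lerDl.
  exact: normc_ge0.
have ndP : nondecreasing_seq P.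
  by move=> m n mn; apply: ler_pM; rewrite ?S0//; exact: ndS.
have cP : cvgn P.
  apply: nondecreasing_is_cvgn => //; exists (Ka * Kb) => _ [N _ <-].
  by apply: ler_pM; rewrite ?S0//; [exact: HKa|exact: HKb].
have key K N : (K * K <= N)%N ->
  normc (dirichlet_sum a s N * dirichlet_sum b s N
         - dirichlet_sum (dconv a b) s N) <= P N - P K.
  move=> KN; have KleN : (K <= N)%N.
    by case: K KN => // K; apply: leq_trans; exact: leq_pmulr.
  rewrite dirichlet_sum_conv /dirichlet_sum big_distrl/=.
  under eq_bigr do rewrite big_distrr/=.
  rewrite -sumrB.
  under eq_bigr => i _.
    rewrite (bigID (fun j => (i * j < N.+1)%N))/= addrAC subrr add0r.
    over.
  have PE M : (M <= N)%N -> P M = \sum_(1 <= i < N.+1)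
      \sum_(1 <= j < N.+1) (if (i <= M)%N && (j <= M)%N
                            then normc (al i) * normc (be j) else 0).
    move=> MN; rewrite /P /SA /SB big_distrl/=.
    rewrite [RHS](big_cat_nat (n := M.+1))//=.
    rewrite [X in _ = _ + X]big_nat_cond [X in _ = _ + X]big1 ?addr0; last first.
      move=> i; rewrite andbT => /andP[Mi _]; rewrite big1// => j _.
      by rewrite leqNgt Mi.
    rewrite big_nat_cond [RHS]big_nat_cond; apply: eq_bigr => i.
    rewrite andbT ltnS => /andP[i1 iM].
    rewrite big_distrr/= [RHS](big_cat_nat (n := M.+1))//=.
    rewrite [X in _ = _ + X]big_nat_cond [X in _ = _ + X]big1 ?addr0; last first.
      by move=> j; rewrite andbT => /andP[Mj _]; rewrite (leqNgt j) Mj andbF.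
    rewrite big_nat_cond [RHS]big_nat_cond; apply: eq_bigr => j.
    by rewrite andbT ltnS => /andP[j1 jM]; rewrite iM jM.
  rewrite (PE N)// (PE K)// -sumrB.
  apply: le_trans (normc_sum _ _ _) _.
  rewrite big_nat_cond [leRHS]big_nat_cond; apply: ler_sum => i.
  rewrite andbT ltnS => /andP[i1 iN].
  apply: le_trans (normc_sum _ _ _) _.
  rewrite -sumrB big_mkcond big_nat_cond [leRHS]big_nat_cond.
  apply: ler_sum => j; rewrite andbT ltnS => /andP[j1 jN]; rewrite iN jN /=.
  have n0 : 0 <= normc (al i) * normc (be j).
    by rewrite mulr_ge0// normc_ge0.
  case: ltnP => ijN /=.
    by case: ifP => _; rewrite ?subrr// subr0.
  case: ifP => [/andP[iK jK]|_].
    by have := leq_mul iK jK; move: ijN KN; lia.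
  by rewrite subr0 -ComplexField.Normc.normcM.
apply/ccvgP => e e0.
have xy : (fun N => dirichlet_sum a s N * dirichlet_sum b s N) @ \oo --> x * y.
  have H := cvgM Ax By; exact: H.
have /ccvgP/(_ (e / 2)) := xy; rewrite divr_gt0// => /(_ isT) [N1 _ HN1].
have /cvgrPdist_lt/(_ (e / 2)) := cP; rewrite divr_gt0// => /(_ isT) [K _ HK].
exists (maxn N1 (K * K)) => // N /=; rewrite geq_max => /andP[N1N KN].
have := HN1 N N1N => /=.
have := key K N KN.
have PN := nondecreasing_cvgn_le ndP cP N.
have := HK K (leqnn K); rewrite /= ger0_norm ?subr_ge0 ?nondecreasing_cvgn_le//.
set A := dirichlet_sum a s N * _; set D := dirichlet_sum (dconv a b) s N.
have -> : D - x * y = - (A - D) + (A - x * y) by rewrite opprB subrKA.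
have := ler_normcD (- (A - D)) (A - x * y); rewrite complex.normcN.
by lra.
Qed.

End dirichlet_lemmas.

Section Hinf_closed.
Variable R : realType.
Local Notation C := R[i].
Implicit Types f g : half_plane R -> C.

Lemma extend0_hp f (s : half_plane R) : extend0 f (val s) = f s.
Proof. by rewrite /extend0 valK. Qed.

Lemma near_half_plane (s : half_plane R) :
  \forall z \near val s, 0 < complex.Re z.
Proof.
case: s => s s0 /=.
apply/nbhs_normP; exists (complex.Re s)%:C => /=; first by rewrite ltcR.
move=> z /= /(le_lt_trans (normc_ge_Re _)); rewrite ltcR raddfB/=.
by move=> /(le_lt_trans (ler_norm _)); rewrite gtrBl.
Qed.

Lemma hp_holomorphic1 : hp_holomorphic (1 : half_plane R -> C).
Proof.
move=> s; apply: (@near_eq_derivable _ _ _ (cst (1 : C))); last first.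
  exact: derivable_cst.
near=> z; have z0 : 0 < complex.Re z by near: z; exact: near_half_plane.
by rewrite /extend0 insubT.
Unshelve. all: by end_near. Qed.

Lemma hp_holomorphicM f g : hp_holomorphic f -> hp_holomorphic g ->
  hp_holomorphic (f * g).
Proof.
move=> hf hg s.
have -> : extend0 (f * g) = extend0 f * extend0 g.
  apply/funext => z; rewrite /extend0/=.
  by rewrite [RHS]/GRing.mul/=; case: insub => [u|] //; rewrite mulr0.
have H := derivableM (hf s) (hg s); exact: H.
Qed.

Lemma hp_holomorphicB f g : hp_holomorphic f -> hp_holomorphic g ->
  hp_holomorphic (f - g).
Proof.
move=> hf hg s.
have -> : extend0 (f - g) = extend0 f - extend0 g.
  apply/funext => z; rewrite /extend0/=.
  by rewrite [RHS]/GRing.add/= /GRing.opp/=; case: insub => [u|] //; rewrite subr0.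
have H := derivableB (hf s) (hg s); exact: H.
Qed.

Lemma hp_holomorphicZ k f : hp_holomorphic f -> hp_holomorphic (k *: f).
Proof.
move=> hf s.
have -> : extend0 (k *: f) = k *: extend0 f.
  apply/funext => z; rewrite /extend0/=.
  rewrite [RHS]/GRing.scale/=; case: insub => [u|] //; exact: esym (mulr0 k).
have H := derivableZ (k := k) (hf s); exact: H.
Qed.

Lemma hp_bounded1 : hp_bounded (1 : half_plane R -> C).
Proof. by exists 1 => s; rewrite ComplexField.Normc.normc1. Qed.

Lemma hp_boundedM f g : hp_bounded f -> hp_bounded g -> hp_bounded (f * g).
Proof.
move=> [M fM] [N gN]; exists (M * N) => s.
by rewrite ComplexField.Normc.normcM ler_pM// normc_ge0.
Qed.

Lemma hp_boundedB f g : hp_bounded f -> hp_bounded g -> hp_bounded (f - g).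
Proof.
move=> [M fM] [N gN]; exists (M + N) => s.
by apply: le_trans (ler_normcD _ _) _; rewrite complex.normcN lerD.
Qed.

Lemma hp_boundedZ k f : hp_bounded f -> hp_bounded (k *: f).
Proof.
move=> [M fM]; exists (normc k * M) => s.
by rewrite ComplexField.Normc.normcM ler_wpM2l// normc_ge0.
Qed.

Lemma dirichlet_series_rep1 : dirichlet_series_rep (1 : half_plane R -> C).
Proof.
exists (fun n => (n == 1)%:R), 0 => s _; apply/ccvgP => e e0.
exists 1 => // N /= N1; rewrite /dirichlet_sum (big_cat_nat (n := 2))//=.
rewrite big_nat1 mul1r dirichlet_pow1 big_nat_cond big1 ?addr0; last first.
  move=> n; rewrite andbT => /andP[n1 _].
  by rewrite (_ : (n == 1)%N = false) ?mul0r// gtn_eqF.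
by rewrite subrr ComplexField.Normc.normc0.
Qed.

Lemma dirichlet_series_repZ k f : dirichlet_series_rep f ->
  dirichlet_series_rep (k *: f).
Proof.
move=> [a [sa Ha]]; exists (fun n => k * a n), sa => s hs.
have -> : dirichlet_sum (fun n => k * a n) (val s) =
    (fun N => k * dirichlet_sum a (val s) N).
  apply/funext => N; rewrite /dirichlet_sum big_distrr/=.
  by apply: eq_bigr => n _; rewrite -mulrA.
have H := cvgMl_tmp (a := k) (Ha s hs); exact: H.
Qed.

Lemma dirichlet_series_repB f g : dirichlet_series_rep f ->
  dirichlet_series_rep g -> dirichlet_series_rep (f - g).
Proof.
move=> [a [sa Ha]] [b [sb Hb]]; exists (fun n => a n - b n), (Num.max sa sb).
move=> s; rewrite gt_max => /andP[hsa hsb].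
have -> : dirichlet_sum (fun n => a n - b n) (val s) =
    (fun N => dirichlet_sum a (val s) N - dirichlet_sum b (val s) N).
  apply/funext => N; rewrite /dirichlet_sum -sumrB.
  by apply: eq_bigr => n _; rewrite mulrBl.
have H := cvgB (Ha s hsa) (Hb s hsb); exact: H.
Qed.

Lemma dirichlet_series_repM f g : dirichlet_series_rep f ->
  dirichlet_series_rep g -> dirichlet_series_rep (f * g).
Proof.
move=> [a [sa Ha]] [b [sb Hb]].
pose sg := Num.max 0 (Num.max sa sb).
have sg0 : 0 < complex.Re (sg + 1)%:C.
  by rewrite /= (le_lt_trans (_ : 0 <= sg)) ?le_max ?lexx// ltrDl.
pose s0 : half_plane R := Sub (sg + 1)%:C sg0.
have sa0 : sa < complex.Re (val s0).
  by rewrite /= (le_lt_trans (_ : sa <= sg)) ?ltrDl// !le_max lexx !orbT.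
have sb0 : sb < complex.Re (val s0).
  by rewrite /= (le_lt_trans (_ : sb <= sg)) ?ltrDl// !le_max lexx !orbT.
exists (dconv a b), (sg + 3) => s hs.
have h2 : complex.Re (val s0) + 2 <= complex.Re (val s).
  by rewrite /= -addrA; apply: ltW; apply: le_lt_trans hs; rewrite lerD2l; lra.
have [Ka HKa] := dirichlet_abs (Ha s0 sa0) h2.
have [Kb HKb] := dirichlet_abs (Hb s0 sb0) h2.
have sas : sa < complex.Re (val s).
  by apply: lt_le_trans sa0 (le_trans _ h2); rewrite lerDl.
have sbs : sb < complex.Re (val s).
  by apply: lt_le_trans sb0 (le_trans _ h2); rewrite lerDl.
exact: (cvg_dirichlet_conv (Ha s sas) (Hb s sbs) HKa HKb).
Qed.

Lemma Hinf_subring : subring_closed (@Hinf_pred R).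
Proof.
split.
- by apply/asboolP; split; [exact: hp_holomorphic1|exact: hp_bounded1|
    exact: dirichlet_series_rep1].
- move=> f g /asboolP[? ? ?] /asboolP[? ? ?]; apply/asboolP; split;
  [exact: hp_holomorphicB|exact: hp_boundedB|exact: dirichlet_series_repB].
- move=> f g /asboolP[? ? ?] /asboolP[? ? ?]; apply/asboolP; split;
  [exact: hp_holomorphicM|exact: hp_boundedM|exact: dirichlet_series_repM].
Qed.

Lemma Hinf_scaler : scaler_closed (@Hinf_pred R).
Proof.
move=> k f /asboolP[? ? ?]; apply/asboolP; split;
  [exact: hp_holomorphicZ|exact: hp_boundedZ|exact: dirichlet_series_repZ].
Qed.

HB.instance Definition _ :=
  GRing.isSubringClosed.Build (half_plane R -> C) (@Hinf_pred R) Hinf_subring.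
HB.instance Definition _ :=
  GRing.isScaleClosed.Build C (half_plane R -> C) (@Hinf_pred R) Hinf_scaler.

End Hinf_closed.

(* Functions on the half-plane itself, so that equality in [Hinf] is equality
   of functions on the half-plane; operations are pointwise. *)
Record Hinf (R : realType) :=
  MkHinf { Hinf_val :> half_plane R -> R[i] ; _ : Hinf_val \in @Hinf_pred R }.

Section Hinf_algebra.
Variable R : realType.
Local Notation C := R[i].

HB.instance Definition _ := [isSub for @Hinf_val R].
HB.instance Definition _ := [Choice of Hinf R by <:].
HB.instance Definition _ :=
  GRing.SubChoice_isSubComPzRing.Build _ _ (Hinf R) (@Hinf_subring R).
HB.instance Definition _ := [SubZmodule_isSubLmodule of Hinf R by <:].

Let hp1 : half_plane R := exist _ (1 : C) ltr01.

Let Hinf1_neq0 : (1 : Hinf R) != 0.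
Proof.
apply/eqP => /(congr1 (fun f => Hinf_val f hp1)) /eqP.
by rewrite /= oner_eq0.
Qed.
HB.instance Definition _ := GRing.PzSemiRing_isNonZero.Build (Hinf R) Hinf1_neq0.

Let Hinf_scalerAl (k : C) (f g : Hinf R) : k *: (f * g) = (k *: f) * g.
Proof. by apply/val_inj/funext => s /=; exact: mulrA. Qed.
HB.instance Definition _ := GRing.Lmodule_isLalgebra.Build C (Hinf R) Hinf_scalerAl.
HB.instance Definition _ := GRing.Lalgebra_isComAlgebra.Build C (Hinf R).

Definition sup_norm (f : Hinf R) : R := sup [set normc (f s) | s in setT].

Lemma sup_normP (f : Hinf R) : has_sup [set normc (f s) | s in setT].
Proof.
split; first by exists (normc (f hp1)), hp1.
by have /asboolP[_ [M fM] _] := valP f; exists M => _ [s _ <-]; exact: fM.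
Qed.

Lemma le_sup_norm (f : Hinf R) s : normc (f s) <= sup_norm f.
Proof. by apply: sup_ubound; [exact: (sup_normP f).2|exists s]. Qed.

Lemma sup_norm_le (f : Hinf R) (M : R) :
  (forall s, normc (f s) <= M) -> sup_norm f <= M.
Proof. by move=> fM; apply: ge_sup; [exact: (sup_normP f).1|move=> _ [s _ <-]]. Qed.

Let normHinf (f : Hinf R) : C := (sup_norm f)%:C.

Let normHinfD (f g : Hinf R) : normHinf (f + g) <= normHinf f + normHinf g.
Proof.
rewrite /normHinf -rmorphD lecR; apply: sup_norm_le => s.
by apply: le_trans (ler_normcD _ _) _; rewrite lerD// le_sup_norm.
Qed.

Lemma sup_normZ (k : C) (f : Hinf R) : sup_norm (k *: f) = normc k * sup_norm f.
Proof.
apply/eqP; rewrite eq_le; apply/andP; split.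
  apply: sup_norm_le => s; rewrite ComplexField.Normc.normcM.
  by rewrite ler_wpM2l ?normc_ge0// le_sup_norm.
have [->|k0] := eqVneq k 0.
  rewrite ComplexField.Normc.normc0 mul0r.
  by apply: le_trans (le_sup_norm _ hp1); exact: normc_ge0.
have nk0 : 0 < normc k.
  rewrite lt_neqAle normc_ge0 andbT eq_sym.
  by apply: contra k0 => /eqP/ComplexField.Normc.eq0_normc ->.
rewrite mulrC -ler_pdivlMr//; apply: sup_norm_le => s.
rewrite ler_pdivlMr// mulrC -ComplexField.Normc.normcM.
exact: (le_sup_norm (k *: f) s).
Qed.

Let normHinfZ (k : C) (f : Hinf R) : normHinf (k *: f) = `|k| * normHinf f.
Proof. by rewrite /normHinf sup_normZ rmorphM. Qed.

Let normHinf0_eq0 (f : Hinf R) : normHinf f = 0 -> f = 0.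
Proof.
move=> [f0]; apply/val_inj/funext => s /=.
apply: ComplexField.Normc.eq0_normc; apply/eqP.
by rewrite eq_le normc_ge0 andbT -f0 le_sup_norm.
Qed.

(* The norm of a normed module over C is C-valued. *)
HB.instance Definition _ :=
  Lmodule_isNormed.Build C (Hinf R) normHinfD normHinfZ normHinf0_eq0.

Lemma Hinf_normE (f : Hinf R) : `|f| = (sup_norm f)%:C.
Proof. by []. Qed.

Lemma Hinf_norm1 : `|1 : Hinf R| = 1.
Proof.
rewrite Hinf_normE; congr (_%:C); apply/eqP; rewrite eq_le; apply/andP; split.
  by apply: sup_norm_le => s; rewrite ComplexField.Normc.normc1.
apply: le_trans (le_sup_norm _ hp1).
by rewrite ComplexField.Normc.normc1.
Qed.

Lemma Hinf_normM_le (f g : Hinf R) : `|f * g| <= `|f| * `|g|.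
Proof.
rewrite !Hinf_normE -rmorphM lecR; apply: sup_norm_le => s.
by rewrite ComplexField.Normc.normcM ler_pM ?normc_ge0 ?le_sup_norm.
Qed.

End Hinf_algebra.

(* Main.v *)
Require Import Defs.
From HB Require Import structures.
From mathcomp Require Import all_boot all_order all_algebra.
From mathcomp Require Import complex.
From mathcomp Require Import all_classical all_reals all_analysis.
From mathcomp Require Import ring lra.

Set Implicit Arguments.
Unset Strict Implicit.
Unset Printing Implicit Defensive.

Import Order.TTheory GRing.Theory Num.Theory numFieldNormedType.Exports.

Local Open Scope classical_set_scope.
Local Open Scope ring_scope.
Local Open Scope complex_scope.

Local Notation normc := ComplexField.Normc.normc.
Local Notation normcM := ComplexField.Normc.normcM.

(** Why the theorem is true.  A Dirichlet series is a power series in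
the infinitely many variables p^(-s), p prime, and this lets one evaluate it
at points other than those of the half-plane: a completely multiplicative
function chi that decays fast enough gives a ring morphism from the algebra to
C, namely f = sum a_n n^(-s) |-> sum a_n chi(n) ([evalM]), which sends p^(-s)
to chi(p).  The numbers chi(p) can be prescribed freely, as long as they are
small.

Fix n, distinct primes p_1, ..., p_n, and suppose that the tuple g_i =
p_i^(-s) + h_i is within e of the tuple p_i^(-s).  Writing chi_z for the
character that takes the value z_i at p_i and 0 at the other primes, one has
chi_z(g_i) = z_i + chi_z(h_i).  As h_i is small, z |-> (- chi_z(h_i))_i is a
contraction of a small polydisc into itself, so by Banach's fixed point
theorem some chi_z kills every g_i ([perturbed_monomials_vanish]).  Then
sum b_i g_i = 1 is impossible since chi_z is a ring morphism.  The size of e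
depends on the primes only, so no tuple close to (p_i^(-s))_i is unimodular,
for any n.

Both the contraction property and the existence of chi_z on the whole algebra
rest on a bound of the coefficients by the norm,
|a_m| <= 4 sup |f| ([coefficient_normc_le]).  In a half-plane of absolute
convergence a_m is the mean value of f(s) m^s on vertical lines.  That
half-plane depends on f, and the bound obtained there would be useless; the
Cauchy-Goursat theorem on long rectangles moves the line of integration to a
line Re s = x with m^x <= 2 at a bounded cost ([vertical_shift_le]), and this
cost disappears from the mean.  The same bound applied to the zero function
gives the uniqueness of the coefficients, hence the morphism property.

Only real line integrals are used: the real part of a contour integral is
expressed through the real and imaginary parts of the integrand, and
multiplying f by the imaginary unit recovers the other component. *)

(** * Integrals of continuous functions over segments *)

Section real_integrals.
Variable R : realType.
Implicit Types (g h : R -> R) (a b c r s K : R).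
Local Notation mu := (@lebesgue_measure R).

Definition rint a b g : R := \int[mu]_(x in `[a, b]) g x.

Definition continuous_on a b g :=
  forall x, a <= x <= b -> {for x, continuous g}.

Lemma continuous_on_integrable a b g : continuous_on a b g ->
  mu.-integrable `[a, b] (EFin \o g).
Proof.
move=> cg; apply: continuous_compact_integrable; first exact: segment_compact.
apply: continuous_in_subspaceT => x; rewrite inE /= in_itv /= => abx.
exact: cg.
Qed.

Lemma rint_split a c b g : a <= c -> c <= b -> continuous_on a b g ->
  rint a b g = rint a c g + rint c b g.
Proof.
move=> ac cb cg; have ig := continuous_on_integrable cg.
have := @Rintegral_itvB R g (BLeft a) (BRight b) c ig.
rewrite !bnd_simp => /(_ ac cb) E.
rewrite /rint; apply/eqP; rewrite addrC -subr_eq; apply/eqP.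
rewrite E Rintegral_itv_obnd_cbnd//.
by apply: integrableS ig => //; apply: subset_itvr; rewrite bnd_simp.
Qed.

Lemma rintD a b g h : continuous_on a b g -> continuous_on a b h ->
  rint a b (fun x => g x + h x) = rint a b g + rint a b h.
Proof. by move=> cg ch; apply: RintegralD => //; exact: continuous_on_integrable. Qed.

Lemma rintB a b g h : continuous_on a b g -> continuous_on a b h ->
  rint a b (fun x => g x - h x) = rint a b g - rint a b h.
Proof. by move=> cg ch; apply: RintegralB => //; exact: continuous_on_integrable. Qed.

Lemma rint_cst a b r : a <= b -> rint a b (fun=> r) = r * (b - a).
Proof.
move=> ab; rewrite /rint Rintegral_cst//= lebesgue_measure_itv/= lte_fin.
by rewrite le_eqVlt in ab; case/predU1P: ab => [->|->]; rewrite ?ltxx ?subrr /=.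
Qed.

Lemma le_rint a b g h : continuous_on a b g -> continuous_on a b h ->
  (forall x, a <= x <= b -> g x <= h x) -> rint a b g <= rint a b h.
Proof.
move=> cg ch gh; by apply: le_Rintegral => //; exact: continuous_on_integrable.
Qed.

Lemma norm_rint_le a b g K : a <= b -> continuous_on a b g ->
  (forall x, a <= x <= b -> `|g x| <= K) -> `|rint a b g| <= K * (b - a).
Proof.
move=> ab cg gK.
have cc r : continuous_on a b (fun=> r) by move=> x _; exact: cvg_cst.
rewrite ler_norml; apply/andP; split.
- rewrite -mulNr -rint_cst//; apply: le_rint => // x /gK.
  by rewrite ler_norml => /andP[].
- rewrite -rint_cst//; apply: le_rint => // x /gK.
  by rewrite ler_norml => /andP[].
Qed.

Lemma rint_FTC a b g h : a <= b -> continuous_on a b h ->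
  (forall x, a <= x <= b -> is_derive x (1 : R) g (h x)) ->
  rint a b h = g b - g a.
Proof.
rewrite le_eqVlt => /predU1P[->|ab] ch dg.
  by rewrite /rint set_itv1 Rintegral_set1 subrr.
have ccg x : a <= x <= b -> g @ x --> g x.
  move=> /dg [D _]; apply: differentiable_continuous.
  by apply/derivable1_diffP.
rewrite /rint /Rintegral (@continuous_FTC2 _ h g a b)//.
- apply: continuous_in_subspaceT => x; rewrite inE /= in_itv /= => abx.
  exact: ch.
- split.
  + by move=> x; rewrite in_itv/= => /andP[ax xb]; case: (dg x) => //; rewrite !ltW.
  + by apply: cvg_at_right_filter; apply: ccg; rewrite lexx ltW.
  + by apply: cvg_at_left_filter; apply: ccg; rewrite lexx ltW.
- move=> x; rewrite in_itv/= => /andP[ax xb].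
  by rewrite derive1E; case: (dg x) => //; rewrite !ltW.
Qed.

(** This is the only quantitative input of the Cauchy-Goursat theorem: the
integral of the affine part is explicit, so that affine contributions can be
cancelled by algebra around a rectangle. *)
Lemma rint_near_affine a b g r s K : a <= b -> continuous_on a b g ->
  (forall x, a <= x <= b -> `|g x - (r + s * x)| <= K) ->
  `|rint a b g - (r * (b - a) + s * (b ^+ 2 - a ^+ 2) / 2)| <= K * (b - a).
Proof.
move=> ab cg gK.
have ca : continuous_on a b (fun x => r + s * x).
  move=> x _; apply: cvgD; first exact: cvg_cst.
  by apply: cvgM; [exact: cvg_cst|exact: cvg_id].
have <- : rint a b (fun x => r + s * x) =
    r * (b - a) + s * (b ^+ 2 - a ^+ 2) / 2.
  have dg x : a <= x <= b ->
      is_derive x (1 : R) (fun x => r * x + s / 2 * x ^+ 2) (r + s * x).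
    by move=> _; apply: is_derive_eq; rewrite /GRing.scale/=; field.
  by rewrite (rint_FTC ab ca dg); field.
rewrite -rintB//; apply: norm_rint_le => // x xab.
by apply: cvgB; [exact: cg|exact: ca].
Qed.

End real_integrals.

(** * Bisection of rectangles *)

Section bisection.
Variable R : realType.
Implicit Types (a b c d x y : R).

Lemma nested_intervals (l r : nat -> R) :
  (forall n, l n <= l n.+1) -> (forall n, r n.+1 <= r n) ->
  (forall n, l n <= r n) -> exists x, forall n, l n <= x <= r n.
Proof.
move=> lS rS lr.
have l_nd : nondecreasing_seq l by apply/nondecreasing_seqP.
have r_ni : nonincreasing_seq r by apply/nonincreasing_seqP.
have lr2 m n : l m <= r n.
  apply: (le_trans (l_nd _ _ (leq_maxl m n))).
  exact: (le_trans (lr _) (r_ni _ _ (leq_maxr m n))).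
exists (sup (range l)) => n; apply/andP; split.
  apply: sup_ubound; last by exists n.
  by exists (r 0) => _ [m _ <-]; exact: lr2.
apply: ge_sup; first by exists (l 0), 0.
by move=> _ [m _ <-]; exact: lr2.
Qed.

(** A property that is inherited from the four quarters of a rectangle and
holds for small rectangles around each point holds for the whole rectangle:
otherwise successive bad quarters shrink to a point that contradicts the local
hypothesis.  Both sides are halved together, so the shape of the rectangle is
preserved along the way. *)
Lemma rect_bisection (P : R -> R -> R -> R -> Prop) a b c d :
  a <= b -> c <= d ->
  (forall a b c d, let m := (a + b) / 2 in let n := (c + d) / 2 in
    P a m c n -> P m b c n -> P a m n d -> P m b n d -> P a b c d) ->
  (forall x y, a <= x <= b -> c <= y <= d -> exists2 e : R, 0 < e &
    forall a' b' c' d', a <= a' -> a' <= x <= b' -> b' <= b ->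
      c <= c' -> c' <= y <= d' -> d' <= d ->
      b' - a' < e -> d' - c' < e -> P a' b' c' d') ->
  P a b c d.
Proof.
move=> ab cd Psplit Plocal; apply: contrapT => nP.
pose mid (p : R * R) := (p.1 + p.2) / 2.
pose half (p q : R * R) := q = (p.1, mid p) \/ q = (mid p, p.2).
pose Q (p : (R * R) * (R * R)) := P p.1.1 p.1.2 p.2.1 p.2.2.
have /choice[nxt Hnxt] : forall p, exists q,
    ~ Q p -> [/\ half p.1 q.1, half p.2 q.2 & ~ Q q].
  move=> p; have [Qp|nQp] := pselect (Q p); first by exists p.
  apply: contrapT => H; apply: nQp.
  have H' I J : half p.1 I -> half p.2 J -> Q (I, J).
    by move=> hI hJ; apply: contrapT => nQ; apply: H; exists (I, J).
  apply: Psplit.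
  - exact: (H' (p.1.1, mid p.1) (p.2.1, mid p.2) (or_introl erefl) (or_introl erefl)).
  - exact: (H' (mid p.1, p.1.2) (p.2.1, mid p.2) (or_intror erefl) (or_introl erefl)).
  - exact: (H' (p.1.1, mid p.1) (mid p.2, p.2.2) (or_introl erefl) (or_intror erefl)).
  - exact: (H' (mid p.1, p.1.2) (mid p.2, p.2.2) (or_intror erefl) (or_intror erefl)).
pose u n := iter n nxt ((a, b), (c, d)).
have nQu n : ~ Q (u n) by elim: n => //= n /Hnxt[].
have hu1 n : half (u n).1 (u n.+1).1 by have [] := Hnxt _ (nQu n).
have hu2 n : half (u n).2 (u n.+1).2 by have [] := Hnxt _ (nQu n).
have key (I : nat -> R * R) : (I 0).1 <= (I 0).2 ->
    (forall n, half (I n) (I n.+1)) ->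
    [/\ exists x, forall n, (I n).1 <= x <= (I n).2,
        forall n, (I 0).1 <= (I n).1 /\ (I n).2 <= (I 0).2 &
        forall n, (I n).2 - (I n).1 = ((I 0).2 - (I 0).1) / 2 ^+ n].
  move=> I0 hI.
  have wI n : (I n).2 - (I n).1 = ((I 0).2 - (I 0).1) / 2 ^+ n.
    elim: n => [|n IH]; first by rewrite expr0 divr1.
    rewrite exprSr invfM mulrA -IH.
    by case: (hI n) => -> /=; rewrite /mid; field.
  have le n : (I n).1 <= (I n).2.
    by rewrite -subr_ge0 wI divr_ge0 ?subr_ge0// exprn_ge0.
  have lS n : (I n).1 <= (I n.+1).1.
    by have := le n; case: (hI n) => -> /=; rewrite /mid; lra.
  have rS n : (I n.+1).2 <= (I n).2.
    by have := le n; case: (hI n) => -> /=; rewrite /mid; lra.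
  split=> //; first exact: nested_intervals lS rS le.
  elim=> // n [h1 h2]; split; first exact: le_trans h1 (lS n).
  exact: le_trans (rS n) h2.
have [[x Hx] inx wx] := key (fun n => (u n).1) ab hu1.
have [[y Hy] iny wy] := key (fun n => (u n).2) cd hu2.
have [e e0 He] := Plocal x y (Hx 0) (Hy 0).
have small w : exists N, forall n, (N <= n)%N -> w / 2 ^+ n < e.
  have : (fun n => geometric w (2^-1 : R) n) @ \oo --> (0 : R).
    by apply: cvg_geometric; rewrite ger0_norm ?invf_lt1 ?ltr1n.
  move=> /cvgrPdist_lt/(_ e e0)[N _ HN]; exists N => n Nn.
  have := HN n Nn; rewrite /= sub0r normrN exprVn.
  exact: le_lt_trans (ler_norm _).
have [N1 HN1] := small (b - a); have [N2 HN2] := small (d - c).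
pose N := maxn N1 N2.
have [ax xb] := inx N; have [cy yd] := iny N.
apply: (nQu N); apply: He => //.
- by have := wx N => /= ->; apply: HN1; rewrite leq_maxl.
- by have := wy N => /= ->; apply: HN2; rewrite leq_maxr.
Qed.

End bisection.

(** * Complex derivatives as first-order approximations *)

Section linear_approximation.

Lemma derivable_eps (K : numFieldType) (F : K^o -> K^o) (z : K^o) :
  derivable F z 1 -> forall e : K, 0 < e ->
    exists2 d : K, 0 < d & forall h : K, `|h| < d ->
      `|F (z + h) - F z - 'D_1 F z * h| <= e * `|h|.
Proof.
move=> /derivable_nbhs/eqaddoP dF e e0.
have [d /= d0 Hd] := dF e e0.
exists d => // h hd; have := Hd h; rewrite /= sub0r normrN => /(_ hd).
suff -> : F (z + h) - F z - 'D_1 F z * h =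
    F (h *: 1 + z) - (F z + h *: 'D_1 F z) by [].
by rewrite /GRing.scale/= mulr1 opprD addrA (addrC h) (mulrC h).
Qed.

Lemma derivableP_eps (K : numFieldType) (F : K^o -> K^o) (z : K^o) :
  derivable F z 1 <-> exists l : K, forall e : K, 0 < e ->
    exists2 d : K, 0 < d & forall h : K, `|h| < d ->
      `|F (z + h) - F z - l * h| <= e * `|h|.
Proof.
split=> [/derivable_eps dF|[l Hl]]; first by exists ('D_1 F z).
apply/cvg_ex; exists l; apply/cvgrPdist_le => e e0.
have [d d0 Hd] := Hl e e0.
exists d => // h /=; rewrite sub0r normrN => hd h0.
have := Hd h hd => H.
rewrite distrC.
have -> : h^-1 *: ((F \o shift z) (h *: 1) - F z) - l =
    h^-1 * (F (z + h) - F z - l * h).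
  by rewrite /GRing.scale/= mulr1 (addrC h) [in RHS]mulrBr mulrCA mulVf ?mulr1.
by rewrite normrM normfV ler_pdivrMl ?normr_gt0// [leRHS]mulrC.
Qed.

Variable R : realType.
Local Notation C := R[i].

Lemma complex_gt0E (e : C) : 0 < e -> e = (complex.Re e)%:C.
Proof.
by move=> e0; apply/eqP; rewrite eq_complex /= eqxx; move: e0; rewrite ltcE => /andP[].
Qed.

(** The norm of the normed module C takes its values in C; the estimates
below are about the real-valued modulus. *)
Lemma derivable_normcP (F : C -> C) (z : C) :
  derivable F z 1 <-> exists l : C, forall e : R, 0 < e ->
    exists2 d : R, 0 < d & forall h : C, normc h < d ->
      normc (F (z + h) - F z - l * h) <= e * normc h.
Proof.
have cE := @derivableP_eps C F z.
split=> [/cE[l Hl]|[l Hl]].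
  exists l => e e0; have := Hl e%:C; rewrite ltcR => /(_ e0)[d d0 Hd].
  move: d0 Hd => /[dup] /complex_gt0E ->; rewrite ltcR => d0 Hd.
  exists (complex.Re d) => // h hd; have := Hd h.
  by rewrite !Defs.normcE ltcR -rmorphM lecR; exact.
apply/cE; exists l => e /[dup] /complex_gt0E ->; rewrite ltcR => e0.
have [d d0 Hd] := Hl _ e0; exists d%:C; rewrite ?ltcR// => h.
by rewrite !Defs.normcE ltcR -rmorphM lecR; exact: Hd.
Qed.

Lemma normr_Re_le (z : C) : `|complex.Re z| <= normc z.
Proof. by have := normc_ge_Re z; rewrite Defs.normcE lecR. Qed.

Lemma normr_Im_le (z : C) : `|complex.Im z| <= normc z.
Proof.
case: z => x y /=; rewrite -sqrtr_sqr ler_wsqrtr// lerDr sqr_ge0//.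
Qed.

Lemma normc_le_ReIm (z : C) : normc z <= `|complex.Re z| + `|complex.Im z|.
Proof.
case: z => x y /=; rewrite -[leRHS]ger0_norm ?addr_ge0// -sqrtr_sqr ler_wsqrtr// sqrrD.
by rewrite !real_normK ?num_real// lerD2r lerDl mulrn_wge0// mulr_ge0.
Qed.

Lemma derivable_continuous_normc (F : C -> C) (z : C) : derivable F z 1 ->
  forall e : R, 0 < e -> exists2 d : R, 0 < d &
    forall h : C, normc h < d -> normc (F (z + h) - F z) < e.
Proof.
move=> /derivable_normcP[l Hl] e e0.
have [d d0 Hd] := Hl 1 ltr01.
have L0 : 0 < normc l + 1 by rewrite ltr_pwDr// normc_ge0.
exists (Num.min d (e / (normc l + 1))).
  by rewrite lt_min d0 divr_gt0.
move=> h; rewrite lt_min => /andP[hd he].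
apply: le_lt_trans (_ : (normc l + 1) * normc h < e); last first.
  by rewrite mulrC -ltr_pdivlMr.
have := Hd h hd; have := ler_normcD (F (z + h) - F z - l * h) (l * h).
rewrite subrK ComplexField.Normc.normcM; nra.
Qed.

End linear_approximation.

(** * The Cauchy-Goursat theorem for rectangles *)

Section goursat.
Variable R : realType.
Local Notation C := R[i].
Implicit Types (F : C -> C) (a b c d x y K : R).

(** The real part of the integral of F around the boundary of the rectangle
with corners a + ic and b + id, oriented counterclockwise: dz is dx on the
horizontal sides and i dy on the vertical ones, whence the imaginary parts. *)
Definition Re_contour F a b c d : R :=
  rint a b (fun x => complex.Re (F (x +i* c)))
  - rint a b (fun x => complex.Re (F (x +i* d)))
  - rint c d (fun y => complex.Im (F (b +i* y)))
  + rint c d (fun y => complex.Im (F (a +i* y))).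

Definition derivable_on_rect F a b c d :=
  forall x y, a <= x <= b -> c <= y <= d -> derivable F (x +i* y) 1.

Lemma derivable_on_rectS F a b c d a' b' c' d' :
  a <= a' -> b' <= b -> c <= c' -> d' <= d ->
  derivable_on_rect F a b c d -> derivable_on_rect F a' b' c' d'.
Proof.
move=> aa bb cc dd dF x y /andP[ax xb] /andP[cy yd]; apply: dF.
  by rewrite (le_trans aa ax) (le_trans xb bb).
by rewrite (le_trans cc cy) (le_trans yd dd).
Qed.

Lemma continuous_on_horizontal F a b c d y : derivable_on_rect F a b c d ->
  c <= y <= d -> continuous_on a b (fun x => complex.Re (F (x +i* y))).
Proof.
move=> dF cyd x axb; apply/(@cvgrPdist_lt _ R^o) => e e0.
have [r r0 Hr] := derivable_continuous_normc (dF x y axb cyd) e0.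
exists r => //= x' /=; rewrite distrC => xr.
have := Hr (x' - x)%:C; rewrite /= expr0n addr0 sqrtr_sqr => /(_ xr).
have -> : (x +i* y) + (x' - x)%:C = x' +i* y :> C.
  by apply/eqP; rewrite eq_complex /= addr0 addrC subrK !eqxx.
rewrite distrC -raddfB/=; apply: le_lt_trans; exact: normr_Re_le.
Qed.

Lemma continuous_on_vertical F a b c d x : derivable_on_rect F a b c d ->
  a <= x <= b -> continuous_on c d (fun y => complex.Im (F (x +i* y))).
Proof.
move=> dF axb y cyd; apply/(@cvgrPdist_lt _ R^o) => e e0.
have [r r0 Hr] := derivable_continuous_normc (dF x y axb cyd) e0.
exists r => //= y' /=; rewrite distrC => yr.
have := Hr (0 +i* (y' - y)); rewrite /= expr0n add0r sqrtr_sqr => /(_ yr).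
have -> : (x +i* y) + (0 +i* (y' - y)) = x +i* y' :> C.
  by apply/eqP; rewrite eq_complex /= addr0 addrC subrK !eqxx.
rewrite distrC -raddfB/=; apply: le_lt_trans; exact: normr_Im_le.
Qed.

Lemma Re_contour_quarters F a b c d : a <= b -> c <= d ->
  derivable_on_rect F a b c d ->
  let m := (a + b) / 2 in let n := (c + d) / 2 in
  Re_contour F a b c d =
    Re_contour F a m c n + Re_contour F m b c n
    + Re_contour F a m n d + Re_contour F m b n d.
Proof.
move=> ab cd dF m n.
have am : a <= m by rewrite /m; lra.
have mb : m <= b by rewrite /m; lra.
have cn : c <= n by rewrite /n; lra.
have nd : n <= d by rewrite /n; lra.
have hs y : c <= y <= d -> rint a b (fun x => complex.Re (F (x +i* y))) =
    rint a m (fun x => complex.Re (F (x +i* y)))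
    + rint m b (fun x => complex.Re (F (x +i* y))).
  by move=> cyd; apply: rint_split => //; exact: continuous_on_horizontal dF _.
have vs x : a <= x <= b -> rint c d (fun y => complex.Im (F (x +i* y))) =
    rint c n (fun y => complex.Im (F (x +i* y)))
    + rint n d (fun y => complex.Im (F (x +i* y))).
  by move=> axb; apply: rint_split => //; exact: continuous_on_vertical dF _.
rewrite /Re_contour (hs c) ?lexx// (hs d) ?lexx ?cd// (vs a) ?lexx// (vs b) ?lexx ?ab//.
ring.
Qed.

(** The contour integral of an affine function vanishes, so only the distance
to an affine function matters; it is integrated over the perimeter. *)
Lemma Re_contour_near_affine F a b c d x y (l : C) K : a <= b -> c <= d ->
  derivable_on_rect F a b c d ->
  (forall x' y', a <= x' <= b -> c <= y' <= d ->
    normc (F (x' +i* y') - F (x +i* y) - l * ((x' - x) +i* (y' - y))) <= K) ->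
  `|Re_contour F a b c d| <= 2 * K * ((b - a) + (d - c)).
Proof.
move=> ab cd dF near_l.
case: l near_l => al be near_l.
set F0 := F (x +i* y) in near_l.
have ReE (u v : C) h k : complex.Re (u - v - (al +i* be) * (h +i* k)) =
    complex.Re u - complex.Re v - (al * h - be * k).
  by case: u v => ? ? [? ?].
have ImE (u v : C) h k : complex.Im (u - v - (al +i* be) * (h +i* k)) =
    complex.Im u - complex.Im v - (al * k + be * h).
  by case: u v => ? ? [? ?].
have hs y' : c <= y' <= d ->
    `|rint a b (fun x => complex.Re (F (x +i* y')))
      - ((complex.Re F0 - al * x - be * (y' - y)) * (b - a)
         + al * (b ^+ 2 - a ^+ 2) / 2)| <= K * (b - a).
  move=> cyd; apply: rint_near_affine => //.
    exact: continuous_on_horizontal dF _.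
  move=> x' axb; apply: le_trans (near_l x' y' axb cyd).
  apply: le_trans (normr_Re_le _).
  by rewrite ReE le_eqVlt; apply/orP; left; apply/eqP; congr `|_|; ring.
have vs x' : a <= x' <= b ->
    `|rint c d (fun y => complex.Im (F (x' +i* y)))
      - ((complex.Im F0 - al * y + be * (x' - x)) * (d - c)
         + al * (d ^+ 2 - c ^+ 2) / 2)| <= K * (d - c).
  move=> axb; apply: rint_near_affine => //.
    exact: continuous_on_vertical dF _.
  move=> y' cyd; apply: le_trans (near_l x' y' axb cyd).
  apply: le_trans (normr_Im_le _).
  by rewrite ImE le_eqVlt; apply/orP; left; apply/eqP; congr `|_|; ring.
have := hs c; rewrite lexx cd => /(_ isT).
have := hs d; rewrite lexx cd => /(_ isT).
have := vs a; rewrite lexx ab => /(_ isT).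
have := vs b; rewrite lexx ab => /(_ isT).
rewrite /Re_contour.
set I1 := rint _ _ _; set I2 := rint _ _ _; set I3 := rint _ _ _; set I4 := rint _ _ _.
set p := complex.Re F0; set q := complex.Im F0.
rewrite !ler_norml => /andP[? ?] /andP[? ?] /andP[? ?] /andP[? ?].
by apply/andP; split; nra.
Qed.

(** Goursat's argument.  The property that is bisected bounds the contour
integral by e times the area, up to the constant aspect ratio rho: it is
additive over the quarters, and near a point of differentiability it follows
from the first-order approximation, whose error and the perimeter are both of
the order of the side length. *)
Lemma goursat F a b c d : a <= b -> c < d -> derivable_on_rect F a b c d ->
  Re_contour F a b c d = 0.
Proof.
move=> ab cd dF.
pose rho := (b - a) / (d - c).
have dc0 : 0 < d - c by rewrite subr_gt0.
have rho0 : 0 <= rho by rewrite divr_ge0 ?subr_ge0// ltW.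
suff small e : 0 < e -> `|Re_contour F a b c d| <= e * (d - c) ^+ 2.
  apply/eqP; rewrite -normr_le0; apply/ler_addgt0Pr => e e0; rewrite add0r.
  have h : 0 < e / (d - c) ^+ 2 by rewrite divr_gt0// exprn_gt0.
  by have := small _ h; rewrite divfK// gt_eqF// exprn_gt0.
move=> e0.
pose P a' b' c' d' := a <= a' -> a' <= b' -> b' <= b ->
  c <= c' -> c' <= d' -> d' <= d -> b' - a' = rho * (d' - c') ->
  `|Re_contour F a' b' c' d'| <= e * (d' - c') ^+ 2.
suff : P a b c d.
  by apply => //; [exact: ltW|rewrite /rho divfK// gt_eqF].
apply: rect_bisection => //; first exact: ltW.
- move=> a' b' c' d' m n P1 P2 P3 P4 aa ab' bb cc cd' dd E.
  have [? ?] : a' <= m /\ m <= b' by rewrite /m; split; lra.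
  have [? ?] : c' <= n /\ n <= d' by rewrite /n; split; lra.
  have quarter a1 b1 c1 d1 : P a1 b1 c1 d1 -> a' <= a1 -> a1 <= b1 ->
      b1 <= b' -> c' <= c1 -> c1 <= d1 -> d1 <= d' ->
      b1 - a1 = (b' - a') / 2 -> d1 - c1 = (d' - c') / 2 ->
      `|Re_contour F a1 b1 c1 d1| <= e * ((d' - c') / 2) ^+ 2.
    move=> P1' ? ? ? ? ? ? E1 E2; rewrite -E2; apply: P1' => //.
    + exact: le_trans aa _.
    + exact: le_trans bb.
    + exact: le_trans cc _.
    + exact: le_trans dd.
    + by rewrite E1 E2 E mulrA.
  rewrite Re_contour_quarters//; last exact: derivable_on_rectS dF.
  rewrite -/m -/n.
  have {}P1 : `|Re_contour F a' m c' n| <= e * ((d' - c') / 2) ^+ 2.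
    by apply: quarter => //; rewrite /m /n; field.
  have {}P2 : `|Re_contour F m b' c' n| <= e * ((d' - c') / 2) ^+ 2.
    by apply: quarter => //; rewrite /m /n; field.
  have {}P3 : `|Re_contour F a' m n d'| <= e * ((d' - c') / 2) ^+ 2.
    by apply: quarter => //; rewrite /m /n; field.
  have {}P4 : `|Re_contour F m b' n d'| <= e * ((d' - c') / 2) ^+ 2.
    by apply: quarter => //; rewrite /m /n; field.
  move: P1 P2 P3 P4.
  rewrite !ler_norml => /andP[? ?] /andP[? ?] /andP[? ?] /andP[? ?].
  by apply/andP; split; nra.
- move=> x y axb cyd.
  have /derivable_normcP[l Hl] := dF x y axb cyd.
  pose k := 2 * (rho + 1) ^+ 2.
  have k0 : 0 < k by rewrite mulr_gt0// exprn_gt0// ltr_wpDl.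
  have [r r0 Hr] := Hl (e / k) (divr_gt0 e0 k0).
  exists (r / 2); first by rewrite divr_gt0.
  move=> a' b' c' d' aa /andP[ax xb] bb cc /andP[cy yd] dd wr hr _ ab' _ _ cd' _ E.
  have dF' : derivable_on_rect F a' b' c' d' by exact: derivable_on_rectS dF.
  have := @Re_contour_near_affine F a' b' c' d' x y l
    (e / k * ((b' - a') + (d' - c'))) ab' cd' dF'.
  have -> : 2 * (e / k * (b' - a' + (d' - c'))) * (b' - a' + (d' - c')) =
      e * (d' - c') ^+ 2.
    by rewrite E /k; field; rewrite gt_eqF// ltr_wpDl.
  apply=> x' y' /andP[ax' xb'] /andP[cy' yd'].
  have hle : normc ((x' - x) +i* (y' - y)) <= (b' - a') + (d' - c').
    apply: le_trans (normc_le_ReIm _) _; rewrite /= lerD// ler_norml.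
      by apply/andP; split; lra.
    by apply/andP; split; lra.
  have hlt : normc ((x' - x) +i* (y' - y)) < r.
    by apply: le_lt_trans hle _; lra.
  have := Hr _ hlt.
  have -> : (x +i* y) + ((x' - x) +i* (y' - y)) = x' +i* y' :> C.
    by apply/eqP; rewrite eq_complex /= ![_ + (_ - _)]addrC !subrK !eqxx.
  move=> /le_trans; apply; rewrite ler_wpM2l//.
  by rewrite divr_ge0// ltW.
Qed.

(** The cost of moving the line of integration does not depend on the height
d - c of the rectangle: only the two horizontal sides contribute. *)
Lemma vertical_shift_le F a b c d M : a <= b -> c < d ->
  derivable_on_rect F a b c d ->
  (forall x y, a <= x <= b -> c <= y <= d -> normc (F (x +i* y)) <= M) ->
  `|rint c d (fun y => complex.Im (F (b +i* y)))| <=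
  `|rint c d (fun y => complex.Im (F (a +i* y)))| + 2 * M * (b - a).
Proof.
move=> ab cd dF FM; have := goursat ab cd dF; rewrite /Re_contour.
have cdW := ltW cd.
have h y : c <= y <= d ->
    `|rint a b (fun x => complex.Re (F (x +i* y)))| <= M * (b - a).
  move=> cyd; apply: norm_rint_le => //.
    exact: continuous_on_horizontal dF _.
  by move=> x axb; apply: le_trans (normr_Re_le _) _; exact: FM.
have := h c; rewrite lexx cdW => /(_ isT).
have := h d; rewrite lexx cdW => /(_ isT).
set I1 := rint _ _ _; set I2 := rint _ _ _; set I3 := rint _ _ _; set I4 := rint _ _ _.
move=> h1 h2 E.
have -> : I3 = I4 + (I2 - I1) by lra.
apply: le_trans (ler_normD _ _) _; rewrite lerD2l.
apply: le_trans (ler_normB _ _) _; lra.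
Qed.

End goursat.

(** * Holomorphy of the exponential *)

Section cexp_derivative.
Variable R : realType.
Local Notation C := R[i].

Lemma is_derive0_eps (g : R -> R) (l : R) : is_derive (0 : R) (1 : R) g l ->
  forall e : R, 0 < e -> exists2 d : R, 0 < d &
    forall h : R, `|h| < d -> `|g h - g 0 - l * h| <= e * `|h|.
Proof.
move=> [dg <-] e e0; have [d d0 Hd] := derivable_eps dg e0.
by exists d => // h /Hd; rewrite add0r.
Qed.

(** Obtained from the real derivatives at 0 of exp, cos and sin, through
exp(x + iy) - 1 - x - iy split into its real and imaginary parts; eta <= 1
serves to bound e^x by 3. *)
Lemma cexp_eps (e : R) : 0 < e -> exists2 d : R, 0 < d &
  forall w : C, normc w < d -> normc (cexp w - 1 - w) <= e * normc w.
Proof.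
move=> e0; pose eta := Num.min 1 (e / 8).
have eta0 : 0 < eta by rewrite lt_min ltr01 divr_gt0.
have eta1 : eta <= 1 by rewrite ge_min lexx.
have etae : 8 * eta <= e.
  by rewrite mulrC -ler_pdivlMr// ge_min lexx orbT.
have [d1 d10 H1] := is_derive0_eps (is_derive_expR 0) eta0.
have [d2 d20 H2] := is_derive0_eps (is_derive_cos 0) eta0.
have [d3 d30 H3] := is_derive0_eps (is_derive_sin 0) eta0.
exists (Num.min (eta / 2) (Num.min d1 (Num.min d2 d3))).
  by rewrite !lt_min divr_gt0// d10 d20 d30.
move=> w; rewrite !lt_min => /and4P[w0 w1 w2 w3].
have Rew := normr_Re_le w; have Imw := normr_Im_le w.
have {H1} := H1 _ (le_lt_trans Rew w1).
have {H2} := H2 _ (le_lt_trans Imw w2).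
have {H3} := H3 _ (le_lt_trans Imw w3).
rewrite expR0 cos0 sin0 !subr0 oppr0 !mul0r !mul1r !subr0 => H3 H2 H1.
apply: le_trans (_ : 8 * eta * normc w <= _); last first.
  by rewrite ler_wpM2r// normc_ge0.
apply: le_trans (normc_le_ReIm _) _.
case: w w0 w1 w2 w3 Rew Imw H3 H2 H1 => x y.
set nw := normc _ => w0 _ _ _; rewrite /cexp /= => Rew Imw.
set E := expR x; set c := cos y; set s := sin y => H3 H2 H1.
have E3 : E <= 3.
  move: H1; rewrite ler_norml => /andP[_ H1].
  have := ler_norm x; nra.
have E0 : 0 <= E by exact: expR_ge0.
have -> : E * c - 0 * s - 1 - x = (E - 1 - x) + E * (c - 1) by ring.
have -> : E * s + 0 * c - 0 - y = E * (s - y) + ((E - 1 - x) + x) * y by ring.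
have A1 : `|E * (c - 1)| <= 3 * (eta * `|y|).
  by rewrite normrM (ger0_norm E0) ler_pM.
have A2 : `|E * (s - y)| <= 3 * (eta * `|y|).
  by rewrite normrM (ger0_norm E0) ler_pM.
have A3 : `|(E - 1 - x + x) * y| <= (eta * 1) * `|y|.
  rewrite normrM ler_wpM2r//; apply: le_trans (ler_normD _ _) _.
  have := normr_ge0 x; nra.
have := ler_normD (E - 1 - x) (E * (c - 1)).
have := ler_normD (E * (s - y)) ((E - 1 - x + x) * y).
nra.
Qed.

Lemma derivable_cexpM (k z : C) : derivable (fun s : C => cexp (k * s)) z 1.
Proof.
apply/derivable_normcP; exists (k * cexp (k * z)) => e e0.
have L0 : 0 < normc k * normc (cexp (k * z)) + 1.
  by rewrite ltr_pwDr// mulr_ge0// normc_ge0.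
have [d d0 Hd] := cexp_eps (divr_gt0 e0 L0).
have k0 : 0 < normc k + 1 by rewrite ltr_pwDr// normc_ge0.
exists (d / (normc k + 1)); first by rewrite divr_gt0.
move=> h; rewrite ltr_pdivlMr// => hd.
have kh : normc (k * h) < d.
  apply: le_lt_trans hd; rewrite ComplexField.Normc.normcM mulrC.
  by rewrite ler_wpM2l ?normc_ge0// lerDl.
have := Hd _ kh.
have -> : cexp (k * (z + h)) - cexp (k * z) - k * cexp (k * z) * h =
    cexp (k * z) * (cexp (k * h) - 1 - k * h).
  by rewrite mulrDr cexpD; ring.
rewrite (ComplexField.Normc.normcM k) (ComplexField.Normc.normcM (cexp _)) => H.
apply: le_trans (ler_wpM2l (normc_ge0 _) H) _.
set p := normc k in L0 *; set q := normc (cexp _) in L0 *.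
have -> : q * (e / (p * q + 1) * (p * normc h)) =
    (p * q) / (p * q + 1) * (e * normc h) by ring.
rewrite ler_piMl ?mulr_ge0 ?normc_ge0 ?(ltW e0)//.
by rewrite ler_pdivrMr// mul1r lerDl.
Qed.

Lemma derivable_dirichlet_pow n (z : C) :
  derivable (dirichlet_pow n : C -> C) z 1.
Proof.
have -> : dirichlet_pow n = fun s : C => cexp (- (ln n%:R)%:C * s).
  by apply/funext => s; rewrite /dirichlet_pow !mulNr mulrC.
exact: derivable_cexpM.
Qed.

End cexp_derivative.

(** * Functions with a bounded primitive *)

Section bounded_primitives.
Variable R : realType.
Implicit Types (g : R -> R) (A B K T lam x y : R).

(** The functions whose integral over [0, T] stays bounded, hence whose mean
value is 0; asking for a primitive makes the class visibly stable under finite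
sums. *)
Definition bounded_primitive g :=
  continuous g /\ exists (G : R -> R) (K : R),
    (forall t, is_derive t (1 : R) G (g t)) /\ (forall t, `|G t| <= K).

Lemma bounded_primitive_rint g : bounded_primitive g ->
  exists K, forall T, 0 <= T -> `|rint 0 T g| <= K.
Proof.
move=> [cg [G [K [dG GK]]]]; exists (K + K) => T T0.
have cg' : continuous_on 0 T g by move=> x _; exact: cg.
rewrite (rint_FTC T0 cg' (fun x _ => dG x)).
by apply: le_trans (ler_normB _ _) _; rewrite lerD.
Qed.

Lemma bounded_primitive_sum (I : Type) (r : seq I) (P : pred I)
  (g : I -> R -> R) : (forall i, P i -> bounded_primitive (g i)) ->
  bounded_primitive (fun t => \sum_(i <- r | P i) g i t).
Proof.
move=> Hg.
have -> : (fun t => \sum_(i <- r | P i) g i t) = \sum_(i <- r | P i) g i.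
  by apply/funext => t; rewrite fct_sumE.
elim/big_ind: _ => //.
  split; first by move=> t; exact: cvg_cst.
  by exists (cst 0), 0; split=> t; [exact: is_derive_cst|rewrite normr0].
move=> g1 g2 [c1 [G1 [K1 [d1 b1]]]] [c2 [G2 [K2 [d2 b2]]]]; split.
  by move=> t; apply: cvgD; [exact: c1|exact: c2].
exists (G1 + G2), (K1 + K2); split=> t; first exact: is_deriveD.
by apply: le_trans (ler_normD _ _) _; rewrite lerD.
Qed.

Lemma bounded_primitive_trig A B lam : lam != 0 ->
  bounded_primitive (fun t => A * cos (lam * t) + B * sin (lam * t)).
Proof.
move=> lam0.
have cl : continuous (fun t : R => lam * t) by move=> t; apply: mulrl_continuous.
split.
  move=> t; apply: cvgD; apply: cvgM; try exact: cvg_cst.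
    by apply: continuous_comp; [exact: cl|exact: continuous_cos].
  by apply: continuous_comp; [exact: cl|exact: continuous_sin].
exists (fun t => A / lam * sin (lam * t) - B / lam * cos (lam * t)),
  (`|A / lam| + `|B / lam|); split=> t.
  have dl : is_derive t (1 : R) (fun t : R => lam * t) lam.
    by apply: is_derive_eq; rewrite /GRing.scale/= mulr1.
  have ds := is_derive1_comp (is_derive_sin (lam * t)) dl.
  have dc := is_derive1_comp (is_derive_cos (lam * t)) dl.
  apply: is_derive_eq.
  by rewrite /GRing.scale/=; field.
apply: le_trans (ler_normB _ _) _; rewrite !normrM lerD// ler_piMr// ?mulr_ge0//.
  by rewrite ler_norml sin_geN1 sin_le1.
by rewrite ler_norml cos_geN1 cos_le1.
Qed.

Lemma le_of_linear_le x y K : (forall T, 0 < T -> x * T <= y * T + K) -> x <= y.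
Proof.
move=> H; rewrite leNgt; apply/negP => yx.
have d0 : 0 < x - y by rewrite subr_gt0.
have T0 : 0 < (`|K| + 1) / (x - y) by rewrite divr_gt0// ltr_wpDl.
have := H _ T0; rewrite -lerBlDl -mulrBl mulrC divfK ?gt_eqF//.
have := ler_norm K; lra.
Qed.

Lemma sum_tail_small (u : nat -> R) K : (forall n, 0 <= u n) ->
  (forall N, \sum_(1 <= n < N.+1) u n <= K) ->
  forall e : R, 0 < e -> exists N0, forall N N' : nat, (N0 <= N <= N')%N ->
    \sum_(N.+1 <= n < N'.+1) u n <= e.
Proof.
move=> u0 uK e e0; pose S N := \sum_(1 <= n < N.+1) u n.
have ndS : nondecreasing_seq S.
  by apply/nondecreasing_seqP => n; rewrite /S [leRHS]big_nat_recr//= lerDl.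
have cS : cvgn S.
  by apply: nondecreasing_is_cvgn => //; exists K => _ [N _ <-]; exact: uK.
have /cvgrPdist_lt/(_ e e0)[N0 _ HN0] := cS.
exists N0 => N N' /andP[N0N NN'].
have -> : \sum_(N.+1 <= n < N'.+1) u n = S N' - S N.
  by rewrite /S [in RHS](big_cat_nat (n := N.+1))//= addrAC subrr add0r.
have := HN0 N N0N; rewrite /= ltr_norml => /andP[_ h].
have := nondecreasing_cvgn_le ndS cS N'; lra.
Qed.

End bounded_primitives.

(** * Bounding the coefficients by the norm *)

Section coefficient_bound.
Variable R : realType.
Local Notation C := R[i].
Implicit Types (a : nat -> C) (f : half_plane R -> C).

(** On a vertical line of absolute convergence the terms have constant modulus,
so the partial sums converge uniformly; integrals over long segments of the
line can then be computed from a single partial sum. *)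
Lemma dirichlet_sum_uniform a (x K : R) :
  (forall N, \sum_(1 <= n < N.+1) normc (a n * dirichlet_pow n x%:C) <= K) ->
  forall e : R, 0 < e -> exists N0, forall N, (N0 <= N)%N ->
    forall s l : C, complex.Re s = x -> dirichlet_sum a s @ \oo --> l ->
    normc (l - dirichlet_sum a s N) <= e.
Proof.
move=> aK e e0; have e20 : 0 < e / 2 by rewrite divr_gt0.
have [N0 HN0] := sum_tail_small (fun n => normc_ge0 _) aK e20.
exists N0 => N NN s l sx /ccvgP/(_ _ e20)[N1 _ HN1].
pose N' := maxn N N1.
have NN' : (N <= N')%N by rewrite leq_maxl.
have := HN1 N'; rewrite /= leq_maxr => /(_ isT) h1.
have h2 : normc (dirichlet_sum a s N' - dirichlet_sum a s N) <= e / 2.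
  rewrite /dirichlet_sum (big_cat_nat (n := N.+1))//= addrAC subrr add0r.
  apply: le_trans (normc_sum _ _ _) _.
  apply: le_trans (HN0 N N' _); last by rewrite NN.
  rewrite le_eqVlt; apply/orP; left; apply/eqP; apply: eq_bigr => n _.
  by rewrite !(normcM (a n)) !normc_dirichlet_pow sx.
rewrite -(subrKA (dirichlet_sum a s N')).
apply: le_trans (ler_normcD _ _) _.
rewrite -opprB complex.normcN; move: h1 h2; lra.
Qed.

Lemma Im_dirichlet_term (z : C) (m n : nat) (x t : R) :
  complex.Im (z * dirichlet_pow n (x +i* t) * cexp ((ln m%:R)%:C * (x +i* t))) =
  expR ((ln m%:R - ln n%:R) * x) *
    (complex.Im z * cos ((ln m%:R - ln n%:R) * t)
     + complex.Re z * sin ((ln m%:R - ln n%:R) * t)).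
Proof.
rewrite /dirichlet_pow -mulrA -cexpD.
have -> : - (x +i* t) * (ln n%:R)%:C + (ln m%:R)%:C * (x +i* t) =
    ((ln m%:R - ln n%:R) * x) +i* ((ln m%:R - ln n%:R) * t) :> C.
  by apply/eqP; rewrite eq_complex /=; apply/andP; split; apply/eqP; ring.
rewrite /cexp /=; case: z => u v /=; ring.
Qed.

(** Multiplication by m^s makes the m-th term of the sum constant while all the
other terms oscillate with the nonzero frequencies ln m - ln n. *)
Lemma Im_dirichlet_sum_twist a (m N : nat) (x : R) : (0 < m <= N)%N ->
  exists2 g : R -> R, bounded_primitive g & forall t,
    complex.Im (dirichlet_sum a (x +i* t) N * cexp ((ln m%:R)%:C * (x +i* t))) =
    complex.Im (a m) + g t.
Proof.
move=> /andP[m0 mN].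
pose lam n : R := ln m%:R - ln n%:R.
pose g n t := expR (lam n * x) * complex.Im (a n) * cos (lam n * t)
  + expR (lam n * x) * complex.Re (a n) * sin (lam n * t).
exists (fun t => \sum_(1 <= n < N.+1 | (0 < n)%N && (n != m)) g n t).
  apply: bounded_primitive_sum => n /andP[n0 nm].
  apply: bounded_primitive_trig.
  apply: contra nm; rewrite subr_eq0 => /eqP/ln_inj.
  by rewrite !posrE !ltr0n => /(_ m0 n0)/eqP; rewrite eqr_nat eq_sym.
move=> t; rewrite /dirichlet_sum mulr_suml raddf_sum/=.
rewrite (bigD1_seq m) ?mem_index_iota ?iota_uniq ?m0//=; congr (_ + _).
  by rewrite Im_dirichlet_term subrr !mul0r expR0 cos0 sin0; ring.
rewrite big_nat_cond [RHS]big_nat_cond; apply: eq_big => n.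
  by case: n.
by move=> _; rewrite Im_dirichlet_term /g; ring.
Qed.

Lemma derivable_extend0_cexp f (m : nat) (a b c d : R) : 0 < a ->
  hp_holomorphic f ->
  derivable_on_rect (fun s => extend0 f s * cexp ((ln m%:R)%:C * s)) a b c d.
Proof.
move=> a0 hf x y /andP[ax _] _.
have xy0 : 0 < complex.Re (x +i* y) by rewrite /= (lt_le_trans a0).
have H := derivableM (hf (exist _ (x +i* y) xy0))
  (@derivable_cexpM R (ln m%:R)%:C (x +i* y)).
exact: H.
Qed.

Lemma normc_extend0_cexp_le f (m : nat) (M b x y : R) : (0 < m)%N -> x <= b ->
  0 <= M -> (forall s, normc (f s) <= M) ->
  normc (extend0 f (x +i* y) * cexp ((ln m%:R)%:C * (x +i* y))) <=
  M * expR (b * ln m%:R).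
Proof.
move=> m0 xb M0 fM; rewrite normcM normc_cexp ler_pM ?normc_ge0 ?expR_ge0//.
  by rewrite /extend0; case: insub => // ; rewrite ComplexField.Normc.normc0.
rewrite ler_expR /= mul0r subr0 mulrC ler_wpM2r// ln_ge0//.
by rewrite ler1n.
Qed.

(** Mean values of Im (f(s) m^s) over segments of height T are compared on two
lines: Re s = x1, where the series converges absolutely and the mean is close
to Im (a m), and Re s = x, where |f(s) m^s| <= 2 M. The errors other than e
are bounded independently of T and vanish after division by T. *)
Lemma coefficient_Im_le f a (sigma0 M : R) (m : nat) : (0 < m)%N ->
  hp_holomorphic f -> (forall s, normc (f s) <= M) ->
  (forall s : half_plane R, sigma0 < complex.Re (val s) ->
    dirichlet_sum a (val s) @ \oo --> f s) ->
  `|complex.Im (a m)| <= 2 * M.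
Proof.
move=> m0 hf fM af.
have M0 : 0 <= M.
  by apply: le_trans (fM (exist _ (1 : C) ltr01)); exact: normc_ge0.
pose L : R := ln m%:R.
have L0 : 0 <= L by rewrite ln_ge0// ler1n.
(* Moving 2 to the right of a point of convergence gives absolute
   convergence; x0 is also kept positive, inside the half-plane. *)
pose x0 := Num.max 0 sigma0 + 1.
have x00 : 0 < complex.Re (x0%:C : C).
  by rewrite /= ltr_wpDl// le_max lexx.
have sx0 : sigma0 < x0.
  by rewrite (le_lt_trans (_ : sigma0 <= Num.max 0 sigma0)) ?ltrDl// le_max lexx orbT.
pose x1 := x0 + 2.
have [K HK] : exists K : R, forall N,
    \sum_(1 <= n < N.+1) normc (a n * dirichlet_pow n x1%:C) <= K.
  by apply: (dirichlet_abs (af (exist _ x0%:C x00) sx0)).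
have l2 : 0 < ln 2 :> R by rewrite ln_gt0// ltr1n.
(* Chosen so that m^x <= 2, the denominator L + 1 being nonzero for m = 1. *)
pose x := Num.min 1 (ln 2 / (L + 1)).
have x_gt0 : 0 < x by rewrite lt_min ltr01 divr_gt0// ltr_wpDl.
have x_x1 : x <= x1.
  apply: (@le_trans _ _ 1); first by rewrite ge_min lexx.
  move: x00; rewrite /x1 /=; lra.
have expx : expR (x * L) <= 2.
  rewrite -[leRHS]lnK ?posrE// ler_expR.
  have : x <= ln 2 / (L + 1) by rewrite ge_min lexx orbT.
  rewrite ler_pdivlMr ?ltr_wpDl//; apply: le_trans.
  by rewrite ler_wpM2l ?lerDl// ltW.
pose F s : C := extend0 f s * cexp (L%:C * s).
pose E1 := expR (x1 * L).
have E10 : 0 < E1 by exact: expR_gt0.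
suff H e : 0 < e -> `|complex.Im (a m)| <= 2 * M + e.
  by apply/ler_addgt0Pr.
move=> e0.
have [N0 HN0] := dirichlet_sum_uniform HK (divr_gt0 e0 E10).
pose N := maxn N0 m.
have mN : (0 < m <= N)%N by rewrite m0 leq_maxr.
have [g bg Hg] := Im_dirichlet_sum_twist a x1 mN.
have [Kg HKg] := bounded_primitive_rint bg.
apply: (@le_of_linear_le _ _ _ (Kg + 2 * (M * E1) * (x1 - x))) => T T0.
have T0W := ltW T0.
have dF : derivable_on_rect F x x1 0 T by exact: derivable_extend0_cexp.
have FM x' y b : x' <= b -> normc (F (x' +i* y)) <= M * expR (b * L).
  by move=> x'b; exact: normc_extend0_cexp_le.
have shift := @vertical_shift_le R F x x1 0 T (M * E1) x_x1 T0 dF.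
have {}shift := shift (fun x' y xx' _ => FM x' y x1 (proj2 (andP xx'))).
have xx1 : x <= x <= x1 by rewrite lexx.
have x1x1 : x <= x1 <= x1 by rewrite lexx andbT.
have left_le : `|rint 0 T (fun y => complex.Im (F (x +i* y)))| <= 2 * M * (T - 0).
  apply: norm_rint_le => //; first exact: continuous_on_vertical dF _.
  move=> y _; apply: le_trans (normr_Im_le _) _.
  apply: le_trans (FM x y x (lexx _)) _.
  by rewrite mulrC ler_wpM2r.
have cg : continuous_on 0 T g by move=> t _; exact: bg.1.
have cF1 : continuous_on 0 T (fun y => complex.Im (F (x1 +i* y))).
  exact: continuous_on_vertical dF _.
have cc : continuous_on 0 T (fun=> complex.Im (a m)).
  by move=> t _; exact: cvg_cst.
have ccg : continuous_on 0 T (fun t => complex.Im (a m) + g t).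
  by move=> t tT; apply: cvgD; [exact: cc|exact: cg].
have right_close : `|rint 0 T (fun y => complex.Im (F (x1 +i* y)))
    - rint 0 T (fun t => complex.Im (a m) + g t)| <= e * (T - 0).
  rewrite -rintB//; apply: norm_rint_le => //.
    by move=> t tT; apply: cvgB; [exact: cF1|exact: ccg].
  move=> t _; rewrite -Hg /F -raddfB/= -mulrBl.
  apply: le_trans (normr_Im_le _) _.
  rewrite normcM normc_cexp.
  have s0 : 0 < complex.Re (x1 +i* t) by exact: lt_le_trans x_x1.
  have -> : extend0 f (x1 +i* t) = f (exist _ (x1 +i* t) s0).
    by rewrite /extend0 insubT.
  have := HN0 N (leq_maxl _ _) (x1 +i* t) (f (exist _ (x1 +i* t) s0)) erefl.
  move=> /(_ (af (exist _ (x1 +i* t) s0) _)) h.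
  rewrite /= mul0r subr0 mulrC -/L (mulrC L) -/E1 -ler_pdivlMl// mulrC.
  by apply: h; rewrite /= /x1 (lt_trans sx0)// ltrDl.
move: right_close; rewrite rintD// rint_cst//.
have := HKg T T0W; move: shift left_le.
set I1 := rint _ _ _; set I2 := rint _ _ _; set I3 := rint _ _ _.
rewrite subr0 => h1 h2 h3.
have -> : `|complex.Im (a m)| * T = `|complex.Im (a m) * T|.
  by rewrite normrM (gtr0_norm T0).
move: (complex.Im (a m) * T) => A h4.
have -> : A = I1 - I3 - (I1 - (A + I3)) by ring.
apply: le_trans (ler_normB _ _) _.
apply: le_trans (lerD (ler_normB _ _) (lexx _)) _.
lra.
Qed.

(** The real part of a m is the imaginary part of the m-th coefficient of the
series multiplied by the imaginary unit. *)
Lemma coefficient_normc_le f a (sigma0 M : R) (m : nat) : (0 < m)%N ->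
  hp_holomorphic f -> (forall s, normc (f s) <= M) ->
  (forall s : half_plane R, sigma0 < complex.Re (val s) ->
    dirichlet_sum a (val s) @ \oo --> f s) ->
  normc (a m) <= 4 * M.
Proof.
move=> m0 hf fM af.
have hIm := coefficient_Im_le m0 hf fM af.
have hRe : `|complex.Re (a m)| <= 2 * M.
  have := @coefficient_Im_le ('i *: f) (fun n => 'i * a n) sigma0 M m m0.
  rewrite (_ : complex.Im ('i * a m) = complex.Re (a m)); last first.
    by case: (a m) => u v /=; rewrite mul0r mul1r add0r.
  apply.
  - exact: hp_holomorphicZ.
  - move=> s; rewrite normcM (_ : normc 'i = 1) ?mul1r//.
    by rewrite /= expr0n expr1n add0r sqrtr1.
  - move=> s hs.
    have -> : dirichlet_sum (fun n => 'i * a n) (val s) =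
        (fun N => 'i * dirichlet_sum a (val s) N).
      apply/funext => N; rewrite /dirichlet_sum big_distrr/=.
      by apply: eq_bigr => n _; rewrite -mulrA.
    have H := cvgMl_tmp (a := 'i : C) (af s hs); exact: H.
apply: le_trans (normc_le_ReIm _) _; lra.
Qed.

End coefficient_bound.

(** * Absolutely convergent series of complex numbers *)

Section absolutely_convergent.
Variable R : realType.
Local Notation C := R[i].

Lemma abs_sum_is_cvg (v : nat -> R) (K : R) :
  (forall N, \sum_(1 <= n < N.+1) `|v n| <= K) ->
  cvgn (fun N => \sum_(1 <= n < N.+1) v n).
Proof.
move=> vK.
have mono_cvg (w : nat -> R) (K' : R) : (forall n, 0 <= w n) ->
    (forall N, \sum_(1 <= n < N.+1) w n <= K') ->
    cvgn (fun N => \sum_(1 <= n < N.+1) w n).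
  move=> w0 wK; apply: nondecreasing_is_cvgn.
    by apply/nondecreasing_seqP => n; rewrite [leRHS]big_nat_recr//= lerDl.
  by exists K' => _ [N _ <-]; exact: wK.
have c1 := mono_cvg _ _ (fun n => normr_ge0 (v n)) vK.
have c2 : cvgn (fun N => \sum_(1 <= n < N.+1) (v n + `|v n|)).
  apply: (mono_cvg _ (K + K)) => [n|N].
    by have := ler_norm (- v n); rewrite normrN; lra.
  rewrite big_split/= lerD//; apply: le_trans (vK N).
  by apply: ler_sum => n _; exact: ler_norm.
have -> : (fun N => \sum_(1 <= n < N.+1) v n) =
    (fun N => \sum_(1 <= n < N.+1) (v n + `|v n|))
    - (fun N => \sum_(1 <= n < N.+1) `|v n|).
  apply/funext => N; rewrite -[RHS]/(_ - _) -sumrB.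
  by apply: eq_bigr => n _; rewrite addrK.
exact: is_cvgB.
Qed.

Lemma complex_abs_sum_cvg (u : nat -> C) (K : R) :
  (forall N, \sum_(1 <= n < N.+1) normc (u n) <= K) ->
  exists l : C, (fun N => \sum_(1 <= n < N.+1) u n) @ \oo --> l.
Proof.
move=> uK.
have cRe : cvgn (fun N => \sum_(1 <= n < N.+1) complex.Re (u n)).
  apply: (@abs_sum_is_cvg _ K) => N; apply: le_trans (uK N).
  by apply: ler_sum => n _; exact: normr_Re_le.
have cIm : cvgn (fun N => \sum_(1 <= n < N.+1) complex.Im (u n)).
  apply: (@abs_sum_is_cvg _ K) => N; apply: le_trans (uK N).
  by apply: ler_sum => n _; exact: normr_Im_le.
move/cvg_ex: cRe => [x /cvgrPdist_lt Hx]; move/cvg_ex: cIm => [y /cvgrPdist_lt Hy].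
exists (x +i* y); apply/ccvgP => e e0.
have e20 : 0 < e / 2 by rewrite divr_gt0.
near=> N; apply: le_lt_trans (normc_le_ReIm _) _.
rewrite !raddfB/= !raddf_sum/= [ltRHS]splitr distrC [X in _ + X]distrC.
apply: ltrD; near: N; [exact: Hx|exact: Hy].
Unshelve. all: by end_near. Qed.

Lemma cvg_normc_le (u : nat -> C) (l : C) (K : R) :
  u @ \oo --> l -> (forall N, normc (u N) <= K) -> normc l <= K.
Proof.
move=> /ccvgP ul uK; apply/ler_addgt0Pr => e e0.
have [N _ HN] := ul e e0; have := HN N (leqnn N) => /= h.
have := ler_normcD (- (u N - l)) (u N); rewrite complex.normcN opprB subrK.
have := uK N; lra.
Qed.

Lemma ccvg_unique (u : nat -> C) (l l' : C) :
  u @ \oo --> l -> u @ \oo --> l' -> l = l'.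
Proof.
move=> /ccvgP ul /ccvgP ul'; apply/subr0_eq/ComplexField.Normc.eq0_normc.
apply/eqP; rewrite eq_le normc_ge0 andbT; apply/ler_addgt0Pr => e e0.
have e20 : 0 < e / 2 by rewrite divr_gt0.
have [N _ HN] := ul _ e20; have [N' _ HN'] := ul' _ e20.
have := HN (maxn N N') (leq_maxl _ _); have := HN' (maxn N N') (leq_maxr _ _).
move=> /= h1 h2; rewrite add0r.
have := ler_normcD (- (u (maxn N N') - l)) (u (maxn N N') - l').
by rewrite complex.normcN opprB subrKA; lra.
Qed.

End absolutely_convergent.

(** * Coefficients of a bounded Dirichlet series *)

Section coefficients.
Variable R : realType.
Local Notation C := R[i].
Implicit Types (a b : nat -> C) (f g : half_plane R -> C) (F G : Hinf R).

Definition represents a f := exists sigma0 : R, forall s : half_plane R,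
  sigma0 < complex.Re (val s) -> dirichlet_sum a (val s) @ \oo --> f s.

Lemma represents_combination a b f g (k : C) :
  represents a f -> represents b g ->
  represents (fun n => a n + k * b n) (f + k *: g).
Proof.
move=> [sa Ha] [sb Hb]; exists (Num.max sa sb).
move=> s; rewrite gt_max => /andP[hsa hsb].
have -> : dirichlet_sum (fun n => a n + k * b n) (val s) =
    (fun N => dirichlet_sum a (val s) N + k * dirichlet_sum b (val s) N).
  apply/funext => N; rewrite /dirichlet_sum big_distrr/= -big_split/=.
  by apply: eq_bigr => n _; rewrite mulrDl mulrA.
have H := cvgD (Ha s hsa) (cvgMl_tmp (a := k) (Hb s hsb)); exact: H.
Qed.

(** The terms of the two series converge absolutely 2 to the right of a common
point of convergence, where their product can be rearranged. *)
Lemma represents_dconv a b f g : represents a f -> represents b g ->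
  represents (dconv a b) (f * g).
Proof.
move=> [sa Ha] [sb Hb].
pose sg := Num.max 0 (Num.max sa sb).
have sg0 : 0 < complex.Re (sg + 1)%:C.
  by rewrite /= (le_lt_trans (_ : 0 <= sg)) ?le_max ?lexx// ltrDl.
pose s0 : half_plane R := Sub (sg + 1)%:C sg0.
have sa0 : sa < complex.Re (val s0).
  by rewrite /= (le_lt_trans (_ : sa <= sg)) ?ltrDl// !le_max lexx !orbT.
have sb0 : sb < complex.Re (val s0).
  by rewrite /= (le_lt_trans (_ : sb <= sg)) ?ltrDl// !le_max lexx !orbT.
exists (sg + 3) => s hs.
have h2 : complex.Re (val s0) + 2 <= complex.Re (val s).
  by rewrite /=; move: hs; lra.
have [Ka HKa] := dirichlet_abs (Ha s0 sa0) h2.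
have [Kb HKb] := dirichlet_abs (Hb s0 sb0) h2.
apply: cvg_dirichlet_conv HKa HKb.
  by apply: Ha; apply: lt_le_trans sa0 (le_trans _ h2); rewrite lerDl.
by apply: Hb; apply: lt_le_trans sb0 (le_trans _ h2); rewrite lerDl.
Qed.

Lemma Hinf_represented F : exists a, represents a F.
Proof. by have /asboolP[_ _ [a Ha]] := valP F; exists a. Qed.

Definition coefs F : nat -> C := projT1 (cid (Hinf_represented F)).

Lemma coefsP F : represents (coefs F) F.
Proof. exact: (projT2 (cid (Hinf_represented F))). Qed.

Lemma represents_normc_le a F n : represents a F -> (0 < n)%N ->
  normc (a n) <= 4 * sup_norm F.
Proof.
move=> [sa Ha] n0; have /asboolP[hF _ _] := valP F.
exact: coefficient_normc_le n0 hF (le_sup_norm F) Ha.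
Qed.

(** The difference of the two series represents the zero function, so the bound
of the coefficients by the norm makes its coefficients vanish. *)
Lemma represents_unique a b F n : represents a F -> represents b F ->
  (0 < n)%N -> a n = b n.
Proof.
move=> Ha Hb n0; apply/subr0_eq/ComplexField.Normc.eq0_normc.
apply/eqP; rewrite eq_le normc_ge0 andbT.
have := represents_combination (-1) Ha Hb.
rewrite (_ : (F : half_plane R -> C) + -1 *: (F : half_plane R -> C) =
             (0 : Hinf R)); last first.
  by apply/funext => s; rewrite scaleN1r subrr.
move=> /represents_normc_le/(_ n0); rewrite mulN1r; move/le_trans; apply.
rewrite pmulr_rle0//; apply: sup_norm_le => s.
by rewrite ComplexField.Normc.normc0.
Qed.

End coefficients.

(** * Evaluating a Dirichlet series along an arithmetic function *)

Section evaluation.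
Variable R : realType.
Local Notation C := R[i].
Implicit Types (a b psi chi : nat -> C) (F G : Hinf R) (D : R).

Definition decays D psi :=
  forall n, (0 < n)%N -> normc (psi n) <= D / n%:R ^+ 2.

(** The partial sums of the series of the a n * psi n, written as a Dirichlet
series at s = 0 so that the theorem on products of Dirichlet series applies to
them. *)
Definition pairing a psi : nat -> C := dirichlet_sum (fun n => a n * psi n) 0.

Lemma dirichlet_pow0 n : dirichlet_pow n (0 : C) = 1.
Proof.
rewrite /dirichlet_pow oppr0 mul0r /cexp /= expR0 cos0 sin0.
by apply/eqP; rewrite eq_complex /= !(mul0r, mulr0, subr0, addr0, mulr1) !eqxx.
Qed.

Lemma pairingE a psi N : pairing a psi N = \sum_(1 <= n < N.+1) a n * psi n.
Proof. by apply: eq_bigr => n _; rewrite dirichlet_pow0 mulr1. Qed.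

Lemma decays_ge0 D psi : decays D psi -> 0 <= D.
Proof.
move=> /(_ 1 (leqnn _)); rewrite expr1n divr1; apply: le_trans; exact: normc_ge0.
Qed.

Lemma pairing_abs_le a F psi D : represents a F -> decays D psi ->
  forall N, \sum_(1 <= n < N.+1) normc (a n * psi n * dirichlet_pow n 0)
    <= 8 * D * sup_norm F.
Proof.
move=> Ha Hpsi N; have D0 := decays_ge0 Hpsi.
have F0 : 0 <= sup_norm F.
  by apply: le_trans (le_sup_norm F (exist _ (1 : C) ltr01)); exact: normc_ge0.
apply: (@le_trans _ _
    (\sum_(1 <= n < N.+1) (4 * sup_norm F * D) * (n%:R ^+ 2)^-1)).
  rewrite big_nat_cond [leRHS]big_nat_cond; apply: ler_sum => n.
  rewrite andbT => /andP[n0 _]; rewrite dirichlet_pow0 mulr1 (normcM (a n)) -mulrA.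
  apply: ler_pM; rewrite ?normc_ge0//; first exact: represents_normc_le.
  exact: Hpsi.
rewrite -big_distrr/= (_ : 8 * D * sup_norm F = 4 * sup_norm F * D * 2); last by ring.
by rewrite ler_wpM2l ?sum_inv_sqr_le2// !mulr_ge0.
Qed.

Definition dirichlet_eval psi F : C :=
  xget 0 [set l | pairing (coefs F) psi @ \oo --> l].

Lemma eval_cvg a F psi D : represents a F -> decays D psi ->
  pairing a psi @ \oo --> dirichlet_eval psi F.
Proof.
move=> Ha Hpsi.
have -> : pairing a psi = pairing (coefs F) psi.
  apply/funext => N; rewrite !pairingE big_nat_cond [RHS]big_nat_cond.
  apply: eq_bigr => n; rewrite andbT => /andP[n0 _].
  by rewrite (represents_unique Ha (coefsP F)).
have [l Hl] := complex_abs_sum_cvg (pairing_abs_le (coefsP F) Hpsi).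
pose L : set C := [set l | pairing (coefs F) psi @ \oo --> l].
by rewrite /dirichlet_eval; apply: (xgetPex 0 (P := L)); exists l.
Qed.

Lemma eval_unique a F psi D l : represents a F -> decays D psi ->
  pairing a psi @ \oo --> l -> dirichlet_eval psi F = l.
Proof. by move=> Ha Hpsi; apply: ccvg_unique; exact: eval_cvg Ha Hpsi. Qed.

Lemma eval_normc_le psi F D : decays D psi ->
  normc (dirichlet_eval psi F) <= 8 * D * sup_norm F.
Proof.
move=> Hpsi; apply: cvg_normc_le (eval_cvg (coefsP F) Hpsi) _ => N.
apply: le_trans (normc_sum _ _ _) _; exact: pairing_abs_le (coefsP F) Hpsi N.
Qed.

Lemma evalB_fun psi chi F D D' D'' : decays D psi -> decays D' chi ->
  decays D'' (fun n => psi n - chi n) ->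
  dirichlet_eval (fun n => psi n - chi n) F =
  dirichlet_eval psi F - dirichlet_eval chi F.
Proof.
move=> Hpsi Hchi H; apply: (eval_unique (coefsP F) H).
have -> : pairing (coefs F) (fun n => psi n - chi n) =
    (fun N => pairing (coefs F) psi N - pairing (coefs F) chi N).
  apply/funext => N; rewrite !pairingE -sumrB.
  by apply: eq_bigr => n _; rewrite mulrBr.
have h := cvgB (eval_cvg (coefsP F) Hpsi) (eval_cvg (coefsP F) Hchi); exact: h.
Qed.

Lemma eval_lipschitz psi chi F D D' D'' : decays D psi -> decays D' chi ->
  decays D'' (fun n => psi n - chi n) ->
  normc (dirichlet_eval psi F - dirichlet_eval chi F) <= 8 * D'' * sup_norm F.
Proof. by move=> Hpsi Hchi H; rewrite -(evalB_fun F Hpsi Hchi H) eval_normc_le. Qed.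

Lemma evalD psi F G D : decays D psi ->
  dirichlet_eval psi (F + G) = dirichlet_eval psi F + dirichlet_eval psi G.
Proof.
move=> Hpsi; have [a Ha] := Hinf_represented F; have [b Hb] := Hinf_represented G.
have HFG : represents (fun n => a n + 1 * b n) (F + G).
  by have := represents_combination 1 Ha Hb; rewrite scale1r.
apply: (eval_unique HFG Hpsi).
have -> : pairing (fun n => a n + 1 * b n) psi =
    (fun N => pairing a psi N + pairing b psi N).
  apply/funext => N; rewrite !pairingE -big_split/=.
  by apply: eq_bigr => n _; rewrite mul1r mulrDl.
have h := cvgD (eval_cvg Ha Hpsi) (eval_cvg Hb Hpsi); exact: h.
Qed.

Definition completely_multiplicative chi := chi 1 = 1 /\
  forall m n, (0 < m)%N -> (0 < n)%N -> chi (m * n)%N = chi m * chi n.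

(** Multiplication by a completely multiplicative function is compatible with
the Dirichlet convolution; this is what turns evaluation into a ring
morphism. *)
Lemma dconv_twist a b chi n : completely_multiplicative chi ->
  dconv (fun n => a n * chi n) (fun n => b n * chi n) n = dconv a b n * chi n.
Proof.
move=> [_ chiM]; rewrite /dconv big_distrl/= big_nat_cond [RHS]big_nat_cond.
apply: eq_bigr => i; rewrite andbT => /andP[i0 _].
rewrite big_distrl/= big_nat_cond [RHS]big_nat_cond.
apply: eq_bigr => j /andP[/andP[j0 _] /eqP <-].
by rewrite chiM//; ring.
Qed.

Lemma evalM chi F G D : completely_multiplicative chi -> decays D chi ->
  dirichlet_eval chi (F * G) = dirichlet_eval chi F * dirichlet_eval chi G.
Proof.
move=> chiM Hchi.
have HFG : represents (dconv (coefs F) (coefs G)) (F * G).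
  exact: (represents_dconv (coefsP F) (coefsP G)).
apply: (eval_unique HFG Hchi).
have -> : pairing (dconv (coefs F) (coefs G)) chi = dirichlet_sum
    (dconv (fun n => coefs F n * chi n) (fun n => coefs G n * chi n)) 0.
  by apply/funext => N; apply: eq_bigr => n _; rewrite dconv_twist.
apply: cvg_dirichlet_conv.
- exact: (eval_cvg (coefsP F) Hchi).
- exact: (eval_cvg (coefsP G) Hchi).
- exact: (pairing_abs_le (coefsP F) Hchi).
- exact: (pairing_abs_le (coefsP G) Hchi).
Qed.

Lemma dirichlet_pow_in_Hinf k : (0 < k)%N ->
  (fun s : half_plane R => dirichlet_pow k (val s)) \in @Hinf_pred R.
Proof.
move=> k0; apply/asboolP; split.
- move=> s; apply: (@near_eq_derivable _ _ _ (dirichlet_pow k : C -> C));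
    last exact: derivable_dirichlet_pow.
  near=> z; have z0 : 0 < complex.Re z by near: z; exact: near_half_plane.
  by rewrite /extend0 insubT.
- exists 1 => s; rewrite normc_dirichlet_pow -[leRHS]expR0 ler_expR mulNr oppr_le0.
  have hs : 0 <= complex.Re (val s) by exact: ltW (valP s).
  have hk : 0 <= ln k%:R :> R by rewrite ln_ge0// ler1n.
  exact: mulr_ge0.
- exists (fun n => (n == k)%:R), 0 => s _; apply/ccvgP => e e0.
  exists k => // N /= kN; rewrite /dirichlet_sum.
  rewrite (bigD1_seq k) ?mem_index_iota ?iota_uniq ?k0//= eqxx mul1r.
  rewrite big1 ?addr0 ?subrr ?ComplexField.Normc.normc0// => n /negPf ->.
  by rewrite mul0r.
Unshelve. all: by end_near. Qed.

End evaluation.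

(** * Fixed points in complex polydiscs *)

HB.instance Definition _ (R : realType) (m n : nat) :=
  Complete.on 'M[R]_(m, n).

Section fixed_point.
Variable R : realType.
Local Notation C := R[i].

Lemma mx_norm_le (m n : nat) (X : 'M[R]_(m, n)) (r : R) : 0 <= r ->
  (forall i j, `|X i j| <= r) -> `|X| <= r.
Proof.
move=> r0 Xr; rewrite [leLHS]mx_normrE.
by apply/bigmax_leP; split=> // -[i j] _; exact: Xr.
Qed.

Lemma le_mx_norm (m n : nat) (X : 'M[R]_(m, n)) i j : `|X i j| <= `|X|.
Proof.
rewrite [leRHS]mx_normrE.
by apply/bigmax_geP; right; exists (i, j).
Qed.

(** Banach's fixed point theorem in the space of real n x 2 matrices, whose two
columns hold real and imaginary parts.  The factors 1/2 and 1/4 absorb the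
comparison between the modulus and the largest of the two parts. *)
Lemma polydisc_fixed_point (n : nat) (T : ('I_n -> C) -> 'I_n -> C) (r : R) :
  0 <= r ->
  (forall z, (forall i, normc (z i) <= r) -> forall i, normc (T z i) <= r / 2) ->
  (forall z w d, (forall i, normc (z i) <= r) -> (forall i, normc (w i) <= r) ->
    (forall i, normc (z i - w i) <= d) ->
    forall i, normc (T z i - T w i) <= d / 4) ->
  exists2 z, (forall i, normc (z i) <= r) & forall i, T z i = z i.
Proof.
move=> r0 Tr Tlip.
pose crd (X : 'M[R]_(n, 2)) i : C := X i 0 +i* X i 1.
pose U := closed_ball_ Num.norm (0 : 'M[R]_(n, 2)) (r / 2).
have crdB X Y i : crd X i - crd Y i = crd (X - Y) i.
  by rewrite /crd !mxE.
have crd_le X i : normc (crd X i) <= 2 * `|X|.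
  apply: le_trans (normc_le_ReIm _) _.
  by have := le_mx_norm X i 0; have := le_mx_norm X i 1; rewrite /=; lra.
have crd_r X : U X -> forall i, normc (crd X i) <= r.
  rewrite /U /closed_ball_ /= sub0r normrN => h i.
  by apply: le_trans (crd_le X i) _; lra.
pose S (X : 'M[R]_(n, 2)) : 'M[R]_(n, 2) := \matrix_(i, j)
  (if j == 0 then complex.Re (T (crd X) i) else complex.Im (T (crd X) i)).
have SU : set_fun U U S.
  move=> X /crd_r/Tr h; rewrite /U /closed_ball_ /= sub0r normrN.
  apply: mx_norm_le => [|i j]; first by rewrite divr_ge0.
  rewrite mxE; apply: le_trans (h i).
  by case: ifP => _; [exact: normr_Re_le|exact: normr_Im_le].
pose f : {fun U >-> U} := HB.pack S (isFun.Build _ _ U U S SU).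
have fc : is_contraction f.
  exists (2^-1)%:nng; split; first by rewrite /= invf_lt1// ltr1n.
  move=> [X Y] [/= /crd_r Xr /crd_r Yr].
  have d i : normc (crd X i - crd Y i) <= 2 * `|X - Y|.
    by rewrite crdB crd_le.
  have h := Tlip _ _ _ Xr Yr d.
  apply: mx_norm_le => [|i j]; first by rewrite mulr_ge0.
  rewrite !mxE; apply: (@le_trans _ _ (normc (T (crd X) i - T (crd Y) i))).
    case: ifP => _; rewrite -raddfB/=; [exact: normr_Re_le|exact: normr_Im_le].
  by apply: le_trans (h i) _; lra.
have [||X UX XE] := banach_fixed_point fc.
- exact: closed_closed_ball_.
- by exists 0; rewrite /U /closed_ball_ /= subrr normr0 divr_ge0.
exists (crd X); first exact: crd_r.
move=> i; have EX j : X i j = S X i j by congr (fun_of_matrix _ i j); exact: XE.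
by rewrite [RHS]/crd !EX !mxE /=; case: (T _ _).
Qed.

End fixed_point.

(** * Completely multiplicative functions with given values at the primes *)

Section characters.
Variable R : realType.
Local Notation C := R[i].
Implicit Types v w : nat -> C.

(** The exponent logn p m is 0 unless p is prime, so the product only sees the
values of v at the primes dividing m. *)
Definition prime_char v (m : nat) : C := \prod_(p < m.+1) v p ^+ logn p m.

Lemma prime_char_widen v (m N : nat) : (m < N)%N ->
  prime_char v m = \prod_(p < N) v p ^+ logn p m.
Proof.
move=> mN; rewrite /prime_char.
rewrite -(big_mkord xpredT (fun p => v p ^+ logn p m)).
rewrite -[RHS](big_mkord xpredT (fun p => v p ^+ logn p m)).
rewrite [RHS](big_cat_nat (n := m.+1))//=.
rewrite [X in _ = _ * X]big_nat_cond [X in _ = _ * X]big1 ?mulr1// => p.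
by rewrite andbT => /andP[mp _]; rewrite ltn_log0.
Qed.

Lemma prime_char_multiplicative v : completely_multiplicative (prime_char v).
Proof.
split.
  by rewrite /prime_char big1// => p _; rewrite logn1.
move=> m n m0 n0; pose N := (m * n).+1.
have mN : (m < N)%N by rewrite ltnS leq_pmulr.
have nN : (n < N)%N by rewrite ltnS leq_pmull.
rewrite (prime_char_widen v mN) (prime_char_widen v nN) /prime_char -big_split/=.
by apply: eq_bigr => p _; rewrite lognM// exprD.
Qed.

Lemma prime_char_prime v p : prime p -> prime_char v p = v p.
Proof.
move=> pp; rewrite /prime_char (bigD1 ord_max)//= logn_prime// eqxx expr1.
rewrite big1 ?mulr1// => i ip; rewrite logn_prime//.
by rewrite (_ : (i == p :> nat) = false) ?expr0//; apply/negbTE; exact: ip.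
Qed.

Lemma prime_mul_ind (P : nat -> Prop) : P 1 ->
  (forall p m, prime p -> (0 < m)%N -> P m -> P (p * m)%N) ->
  forall m, (0 < m)%N -> P m.
Proof.
move=> P1 PM; elim/ltn_ind => m IH m0.
have [->//|m1] := eqVneq m 1%N.
have {}m1 : (1 < m)%N by rewrite ltn_neqAle eq_sym m1.
have pp := pdiv_prime m1; have pm := pdiv_dvd m.
rewrite -(divnK pm) mulnC; apply: PM => //.
  by rewrite divn_gt0 ?pdiv_gt0// dvdn_leq.
apply: IH; first by rewrite ltn_Pdiv// prime_gt1.
by rewrite divn_gt0 ?pdiv_gt0// dvdn_leq.
Qed.

(** One power more than the decay asked of a character: the Lipschitz estimate
below loses a factor 2 at each prime p, which the spare factor 1/p absorbs. *)
Definition cube_decay v := forall p, prime p -> normc (v p) <= (p%:R ^+ 3)^-1.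

Lemma prime_char_cube_decay v m : cube_decay v -> (0 < m)%N ->
  normc (prime_char v m) <= (m%:R ^+ 3)^-1.
Proof.
move=> dv; have [char1 charM] := prime_char_multiplicative v.
elim/prime_mul_ind: m / => [|p m pp m0 IH].
  by rewrite char1 ComplexField.Normc.normc1 expr1n invr1.
have p0 := prime_gt0 pp.
rewrite charM// prime_char_prime// (normcM (v p)) natrM exprMn invfM.
by rewrite ler_pM ?normc_ge0// dv.
Qed.

Lemma prime_char_decays v : cube_decay v -> decays 1 (prime_char v).
Proof.
move=> dv m m0; apply: le_trans (prime_char_cube_decay dv m0) _.
rewrite mul1r lef_pV2 ?posrE ?exprn_gt0 ?ltr0n// ler_weXn2l//.
by rewrite ler1n.
Qed.

(** By induction on the number of prime factors, from the Leibniz-like identity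
v w - v' w' = (v - v') w + v' (w - w').  The constant D does not grow because
2 / p^3 <= 1 / p^2. *)
Lemma prime_char_lipschitz v w (D : R) : 0 <= D ->
  cube_decay v -> cube_decay w ->
  (forall p, prime p -> normc (v p - w p) <= D / p%:R ^+ 3) ->
  decays D (fun m => prime_char v m - prime_char w m).
Proof.
move=> D0 dv dw dvw; have [v1 vM] := prime_char_multiplicative v.
have [w1 wM] := prime_char_multiplicative w.
move=> m; elim/prime_mul_ind: m / => [|p m pp m0 IH].
  by rewrite v1 w1 subrr ComplexField.Normc.normc0 divr_ge0// exprn_ge0.
have p0 := prime_gt0 pp; rewrite vM ?wM// (prime_char_prime v)// (prime_char_prime w)//.
have -> : v p * prime_char v m - w p * prime_char w m =
    (v p - w p) * prime_char v m + w p * (prime_char v m - prime_char w m).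
  by ring.
apply: le_trans (ler_normcD _ _) _.
rewrite (normcM (v p - w p)) (normcM (w p)).
have p0R : 0 < p%:R :> R by rewrite ltr0n.
have m0R : 0 < m%:R :> R by rewrite ltr0n.
have h1 : normc (prime_char v m) <= (m%:R ^+ 2)^-1.
  by have := prime_char_decays dv m0; rewrite mul1r.
have h2 := ler_pM (normc_ge0 _) (normc_ge0 _) (dvw p pp) h1.
have h3 := ler_pM (normc_ge0 _) (normc_ge0 _) (dw p pp) IH.
apply: le_trans (lerD h2 h3) _.
have -> : D / p%:R ^+ 3 / m%:R ^+ 2 + (p%:R ^+ 3)^-1 * (D / m%:R ^+ 2) =
    (D / (p%:R * m%:R) ^+ 2) * (2 / p%:R) :> R.
  by field; rewrite !gt_eqF.
rewrite natrM; apply: ler_piMr.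
  by rewrite divr_ge0// exprn_ge0// mulr_ge0// ltW.
by rewrite ler_pdivrMr// mul1r ler_nat prime_gt1.
Qed.

End characters.

(** * Tuples close to the prime monomials are not unimodular *)

Section primes.

Fixpoint some_prime (i : nat) : nat :=
  if i is j.+1 then s2val (prime_above (some_prime j)) else 2.

Lemma some_prime_prime i : prime (some_prime i).
Proof. by case: i => //= i; exact: (s2valP' (prime_above _)). Qed.

Lemma some_prime_mono : {homo some_prime : i j / (i < j)%N}.
Proof.
apply: homo_ltn => [|i]; first exact: ltn_trans.
exact: (s2valP (prime_above (some_prime i))).
Qed.

Lemma some_prime_inj : injective some_prime.
Proof.
move=> i j eij; by case: (ltngtP i j) => // /some_prime_mono;
  rewrite eij ltnn.
Qed.

End primes.

Section common_zero.
Variable R : realType.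
Local Notation C := R[i].
Implicit Types (chi : nat -> C) (F G : Hinf R).

Definition prime_monomial i : Hinf R :=
  MkHinf (dirichlet_pow_in_Hinf R (prime_gt0 (some_prime_prime i))).

Lemma sum_delta (x : nat -> C) (k N : nat) : (0 < k <= N)%N ->
  \sum_(1 <= n < N.+1) (n == k)%:R * x n = x k.
Proof.
move=> /andP[k0 kN].
rewrite (bigD1_seq k) ?mem_index_iota ?iota_uniq ?k0//= eqxx mul1r.
by rewrite big1 ?addr0// => n /negPf ->; rewrite mul0r.
Qed.

Lemma eval_dirichlet_pow chi D F k : (0 < k)%N -> decays D chi ->
  (forall s, F s = dirichlet_pow k (val s)) -> dirichlet_eval chi F = chi k.
Proof.
move=> k0 Hchi HF.
have HR : represents (fun n => (n == k)%:R) F.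
  exists 0 => s _; apply/ccvgP => e e0; exists k => // N /= kN.
  by rewrite /dirichlet_sum sum_delta ?k0// HF subrr ComplexField.Normc.normc0.
apply: (eval_unique HR Hchi); apply/ccvgP => e e0; exists k => // N /= kN.
by rewrite pairingE sum_delta ?k0// subrr ComplexField.Normc.normc0.
Qed.

Lemma eval1 chi D : completely_multiplicative chi -> decays D chi ->
  dirichlet_eval chi (1 : Hinf R) = 1.
Proof.
move=> [chi1 _] Hchi; rewrite (eval_dirichlet_pow (ltnSn 0) Hchi) ?chi1// => s.
by rewrite dirichlet_pow1.
Qed.

Lemma eval_sum chi D n (F : 'I_n -> Hinf R) : decays D chi ->
  dirichlet_eval chi (\sum_i F i) = \sum_i dirichlet_eval chi (F i).
Proof.
move=> Hchi; elim/big_rec2: _ => [|i x y _ <-]; last by rewrite (evalD _ _ Hchi).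
have := evalD 0 0 Hchi; rewrite addr0 => /eqP.
by rewrite -[X in X == _]addr0 (can_eq (addKr _)) => /eqP.
Qed.

(** The fixed point equation z_i = - chi_z(h_i) says that chi_z vanishes at
p_i^(-s) + h_i.  The radius r = p^(-3), where p bounds the primes in use,
guarantees that chi_z decays, and e is r / 32 because the bound of the
evaluation by the norm has the constant 8. *)
Lemma perturbed_monomials_vanish (n : nat) : exists2 e : R, 0 < e &
  forall g : 'I_n -> Hinf R,
    (forall i, sup_norm (g i - prime_monomial i) <= e) ->
  exists chi, [/\ completely_multiplicative chi, decays 1 chi &
    forall i, dirichlet_eval chi (g i) = 0].
Proof.
pose P3 : R := (some_prime n)%:R ^+ 3.
have P30 : 0 < P3 by rewrite exprn_gt0// ltr0n prime_gt0 ?some_prime_prime.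
pose r := P3^-1.
have r0 : 0 < r by rewrite invr_gt0.
have prP (i : 'I_n) : (some_prime i)%:R ^+ 3 <= P3.
  by rewrite lerXn2r ?nnegrE ?ler0n// ler_nat ltnW// some_prime_mono.
have pr30 (i : 'I_n) : 0 < (some_prime i)%:R ^+ 3 :> R.
  by rewrite exprn_gt0// ltr0n prime_gt0 ?some_prime_prime.
exists (r / 32); first by rewrite divr_gt0.
move=> g gh; pose h i := g i - prime_monomial i.
pose v (z : 'I_n -> C) p := \sum_(i < n | some_prime i == p) z i.
have v_prime z (i : 'I_n) : v z (some_prime i) = z i.
  rewrite /v (big_pred1 i)// => j.
  by rewrite (inj_eq some_prime_inj).
have v_bound z (d : R) : 0 <= d -> (forall i, normc (z i) <= d) ->
    forall p, prime p -> normc (v z p) <= d * P3 / p%:R ^+ 3.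
  move=> d0 zd p pp.
  have p0 : 0 < p%:R ^+ 3 :> R by rewrite exprn_gt0// ltr0n prime_gt0.
  have [i /eqP <-|none] := pickP (fun i : 'I_n => some_prime i == p).
    rewrite v_prime ler_pdivlMr//.
    by apply: ler_pM; rewrite ?normc_ge0 ?zd ?prP ?exprn_ge0.
  rewrite /v big_pred0// ComplexField.Normc.normc0.
  by rewrite divr_ge0 ?mulr_ge0// ltW.
have v_cube z : (forall i, normc (z i) <= r) -> cube_decay (v z).
  move=> zr p pp; have := v_bound z r (ltW r0) zr p pp.
  by rewrite mulVf ?gt_eqF// mul1r.
have [||z zr zfix] := @polydisc_fixed_point R n
    (fun z i => - dirichlet_eval (prime_char (v z)) (h i)) r (ltW r0).
- move=> z zr i; rewrite complex.normcN.
  apply: le_trans (eval_normc_le _ (prime_char_decays (v_cube z zr))) _.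
  by have := gh i; rewrite -/(h i); lra.
- move=> z w d zr wr zwd i.
  have d0 : 0 <= d by apply: le_trans (zwd i); exact: normc_ge0.
  have dz := v_cube z zr; have dw := v_cube w wr.
  have dzw p : prime p -> normc (v z p - v w p) <= d * P3 / p%:R ^+ 3.
    move=> pp; rewrite /v -sumrB.
    exact: (v_bound (fun i => z i - w i) d d0 zwd p pp).
  have dP0 : 0 <= d * P3 by rewrite mulr_ge0// ltW.
  have H := prime_char_lipschitz dP0 dz dw dzw.
  rewrite -opprD complex.normcN.
  apply: le_trans (eval_lipschitz _ (prime_char_decays dz) (prime_char_decays dw) H) _.
  apply: (@le_trans _ _ (8 * (d * P3) * (r / 32))).
    by rewrite ler_wpM2l ?mulr_ge0// gh.
  by rewrite /r le_eqVlt; apply/orP; left; apply/eqP; field; rewrite gt_eqF.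
have dz := prime_char_decays (v_cube z zr).
have zM := prime_char_multiplicative (v z).
exists (prime_char (v z)); split=> // i.
have -> : g i = h i + prime_monomial i by rewrite subrK.
rewrite (evalD _ _ dz).
rewrite (@eval_dirichlet_pow _ _ (prime_monomial i) (some_prime i) _ dz) //.
  by rewrite prime_char_prime ?some_prime_prime// v_prime -[X in _ + X]zfix addrN.
exact: prime_gt0 (some_prime_prime i).
Qed.

Lemma unimodular_not_dense (n : nat) : (0 < n)%N ->
  ~ dense (@unimodular (Hinf R) n : set 'rV[Hinf R]_n).
Proof.
move=> n0 dense_n.
have [e e0 He] := perturbed_monomials_vanish n.
pose f : 'rV[Hinf R]_n := \row_i prime_monomial i.
pose B : set 'rV[Hinf R]_n :=
  [set g | forall i : 'I_n, sup_norm ((g : 'rV[Hinf R]_n) 0 i - prime_monomial i) <= e].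
have Bf : nbhs f B.
  exists (fun _ j => ball (prime_monomial j) e%:C).
    by move=> i j; rewrite mxE; apply: nbhsx_ballx; rewrite ltcR.
  move=> g Hg i; have := Hg 0 i.
  by rewrite -ball_normE /= distrC Hinf_normE ltcR => /ltW.
have [|g [/interior_subset Bg [b bg1]]] := dense_n B° _ (open_interior B).
  by exists f.
have [chi [chiM dchi chi0]] := He (fun i => g 0 i) Bg.
have := eval1 chiM dchi; rewrite -bg1 (eval_sum _ dchi) big1.
  by move/eqP; rewrite eq_sym oner_eq0.
by move=> i _; rewrite (evalM _ _ chiM dchi) chi0 mulr0.
Qed.

End common_zero.

Theorem corollary1p8 (R : realType) :
  topological_stable_rank (Hinf R) = +oo%E.
Proof. exact/topological_stable_rank_pinfty/unimodular_not_dense. Qed.
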